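(* The Fair-NET problem restricted to regular graphs $G$ is fixed-parameter tractable parameterized by $\mathtt{fvs}(G)$; that is, there is an algorithm that, given a regular graph $G$ and a multiset $S$, decides whether $G$ is $S$-fair in time $g(\mathtt{fvs}(G))\cdot N^{O(1)}$ for some computable function $g$, where $N$ is the size of the input.
   Context: Fair-NET problem: the input is a finite simple undirected graph $G$ and a multiset $S$ of positive integers with $|S|=|V(G)|$. The graph $G$ is called $S$-fair if there is a bijection $f$ from $V(G)$ to $S$ (each occurrence of an element of the multiset $S$ is assigned to exactly one vertex) and a constant $k$ such that for every vertex $v\in V(G)$, $\sum_{u\in N_G(v)} f(u)=k$, where $N_G(v)$ is the set of neighbours of $v$. The question is whether $G$ is $S$-fair. A graph is regular ($r$-regular) if every vertex has the same degree $r$. $\mathtt{fvs}(G)$ is the minimum size of a set of vertices whose removal makes $G$ acyclic. *)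

(* Defs.v *)
From mathcomp Require Import all_boot.
Set Implicit Arguments.
Unset Strict Implicit.
Unset Printing Implicit Defensive.

Record sgraph (V : finType) := SGraph {
  adj :> rel V;
  adj_sym : symmetric adj;
  adj_irrefl : irreflexive adj
}.

Section Graphs.
Variables (V : finType) (G : sgraph V).

Definition nbhd (v : V) : {set V} := [set u | G v u].

Definition regular : Prop := exists r : nat, forall v : V, #|nbhd v| = r.

(* Occurrences of elements of the multiset listed by [S] are the positions of
   the list, so a bijection from the vertices to [S] is a bijection onto
   ['I_(size S)]. *)
Definition fair (S : seq nat) : Prop :=
  exists pi : V -> 'I_(size S), bijective pi /\
  exists k : nat, forall v : V, \sum_(u in nbhd v) nth 0 S (pi u) = k.

(* The subgraph induced by [A] has no cycle; a cycle of a simple graph has at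
   least three vertices, all distinct, hence at most [#|V|] of them. *)
Definition acyclic_on (A : {set V}) : bool :=
  [forall m : 'I_#|V|.+1, forall c : m.-tuple V,
    ~~ [&& 2 < m, all (mem A) c & ucycleb G c]].

Lemma acyclic_onP (A : {set V}) :
  reflect (forall c : seq V, 2 < size c -> {subset c <= A} -> ~ ucycle G c)
          (acyclic_on A).
Proof.
apply: (iffP forallP) => [acA c c2 cA cyc | acA m].
  have Uc : uniq c by case/andP: cyc.
  have lt_c : size c < #|V|.+1 by rewrite ltnS -(card_uniqP Uc) max_card.
  have /forallP/(_ (in_tuple c)) := acA (Ordinal lt_c).
  by rewrite /= c2 (introT allP) //= [ucycleb _ _]cyc.
apply/forallP => c; apply/negP => /and3P[m2 /allP cA cyc].
by apply: (acA c) => //; rewrite size_tuple.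
Qed.

Definition feedback_vertex_set (X : {set V}) : bool := acyclic_on (~: X).

Lemma feedback_setT : feedback_vertex_set [set: V].
Proof.
apply/acyclic_onP => -[//|x c] _ /(_ x (mem_head _ _)).
by rewrite setCT inE.
Qed.

Definition fvs : nat := #|[arg min_(X < [set: V] | feedback_vertex_set X) #|X|]|.

Lemma fvsP :
  (exists2 X, feedback_vertex_set X & #|X| = fvs) /\
  (forall X, feedback_vertex_set X -> fvs <= #|X|).
Proof.
rewrite /fvs; case: arg_minnP => [|X fX minX]; first exact: feedback_setT.
by split=> //; exists X.
Qed.

End Graphs.

(* Time is measured on random access machines with the instruction set of Cook
   and Reckhow (constants, addition, truncated subtraction, indirect load and
   store, test for zero) and logarithmic cost: a step is charged the binary
   length of all addresses and operands it handles.  This model and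
   multi-tape Turing machines simulate each other with polynomial overhead.
   Control flow is structured rather than given by jumps, and the finitely many
   registers a program names are kept apart from the addressable memory. *)

Definition bitlen (n : nat) : nat := (trunc_log 2 n).+1.

Inductive prog : Type :=
| Skip
| Const (x c : nat)         (* R[x] := c            *)
| Add (x y z : nat)         (* R[x] := R[y] + R[z]  *)
| Sub (x y z : nat)         (* R[x] := R[y] - R[z]  *)
| Fetch (x y : nat)         (* R[x] := M[R[y]]      *)
| Store (x y : nat)         (* M[R[x]] := R[y]      *)
| Seq (p q : prog)
| If (x : nat) (p q : prog) (* p when R[x] <> 0     *)
| While (x : nat) (p : prog).

Record state := State { regs : nat -> nat; mem : nat -> nat }.

Definition upd (f : nat -> nat) (i v : nat) : nat -> nat :=
  fun j => if j == i then v else f j.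

Definition set_reg (s : state) (x v : nat) : state :=
  State (upd (regs s) x v) (mem s).

Definition set_mem (s : state) (a v : nat) : state :=
  State (regs s) (upd (mem s) a v).

(* [exec p s t s']: started in [s], the program [p] halts in [s'] after a
   computation of total cost [t]; a diverging run has no derivation. *)
Inductive exec : prog -> state -> nat -> state -> Prop :=
| exec_skip s : exec Skip s 1 s
| exec_const s x c : exec (Const x c) s (1 + bitlen c) (set_reg s x c)
| exec_add s x y z :
    exec (Add x y z) s (1 + bitlen (regs s y) + bitlen (regs s z))
      (set_reg s x (regs s y + regs s z))
| exec_sub s x y z :
    exec (Sub x y z) s (1 + bitlen (regs s y) + bitlen (regs s z))
      (set_reg s x (regs s y - regs s z))
| exec_load s x y :
    exec (Fetch x y) s (1 + bitlen (regs s y) + bitlen (mem s (regs s y)))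
      (set_reg s x (mem s (regs s y)))
| exec_store s x y :
    exec (Store x y) s (1 + bitlen (regs s x) + bitlen (regs s y))
      (set_mem s (regs s x) (regs s y))
| exec_seq p q s1 s2 s3 t1 t2 :
    exec p s1 t1 s2 -> exec q s2 t2 s3 -> exec (Seq p q) s1 (t1 + t2) s3
| exec_if_true x p q s s' t :
    regs s x != 0 -> exec p s t s' ->
    exec (If x p q) s (1 + bitlen (regs s x) + t) s'
| exec_if_false x p q s s' t :
    regs s x = 0 -> exec q s t s' ->
    exec (If x p q) s (1 + bitlen (regs s x) + t) s'
| exec_while_true x p s1 s2 s3 t1 t2 :
    regs s1 x != 0 -> exec p s1 t1 s2 -> exec (While x p) s2 t2 s3 ->
    exec (While x p) s1 (1 + bitlen (regs s1 x) + t1 + t2) s3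
| exec_while_false x p s :
    regs s x = 0 -> exec (While x p) s (1 + bitlen (regs s x)) s.

Lemma exec_det p s t1 s1 t2 s2 :
  exec p s t1 s1 -> exec p s t2 s2 -> t1 = t2 /\ s1 = s2.
Proof.
move=> run1; elim: run1 t2 s2 => {p s t1 s1} *;
  match goal with run2 : exec _ _ ?t ?s |- _ = ?t /\ _ = ?s =>
    inversion run2; subst; clear run2 end;
  repeat match goal with
    IH : forall t s, exec ?p ?s0 t s -> _, run : exec ?p ?s0 _ _ |- _ =>
      case: (IH _ _ run) => ? ?; clear IH run; subst end;
  try by [].
all: match goal with
  nz : is_true (regs ?s ?x != 0), z : regs ?s ?x = 0 |- _ =>
    by rewrite z in nz end.
Qed.

Definition init (w : seq nat) : state := State (fun=> 0) (nth 0 w).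

(* The result of a run is the final content of register 0. *)
Definition runs (p : prog) (w : seq nat) (t out : nat) : Prop :=
  exists2 s : state, exec p (init w) t s & regs s 0 = out.

Definition computable (g : nat -> nat) : Prop :=
  exists q : prog, forall n : nat, exists t : nat, runs q [:: n] t (g n).

Definition input_size (w : seq nat) : nat := \sum_(a <- w) bitlen a.

(* The number of vertices, the adjacency matrix row by row, then [S]. *)
Definition encode (n : nat) (G : sgraph 'I_n) (S : seq nat) : seq nat :=
  n :: [seq nat_of_bool (G i j) | i <- enum 'I_n, j <- enum 'I_n] ++ S.

(* Main.v *)
(* In a [k]-regular graph with [k >= 3] the vertices outside a feedback vertex
   set [X] span a forest, so at most twice their number of edge ends stay inside
   it while the others lead to [X]; this gives [n <= 4 |X|].  In a 2-regular
   graph, a disjoint union of cycles each meeting [X], every fair labelling takes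
   equal values four steps apart, hence is constant on the classes of a relation
   all of whose classes meet the ball of radius 3 around [X].  In a 1-regular
   graph it is constant.  So unless the graph has no edge (when any labelling is
   fair), a fair labelling is constant on [c = O(fvs)] classes computable in
   polynomial time; then [S] has at most [c] distinct values, and the
   [2 ^ (c * c)] boolean matrices, among them all assignments of distinct values
   to classes, can be tried in turn.

   The algorithm is a closed term of a small language of loop expressions, where
   a loop makes [n] or [2 ^ (c * c)] turns, so that the number of instructions
   run is polynomial in both.  Sets of vertices are coded as numbers, and the
   memory is never written. *)
Require Import Defs.
From mathcomp Require Import all_boot.
From mathcomp Require Import zify.
Set Implicit Arguments.
Unset Strict Implicit.
Unset Printing Implicit Defensive.

(** * Cost of straight-line and looping programs *)

Lemma bitlen_le v B : 0 < B -> v < 2 ^ B -> bitlen v <= B.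
Proof.
case: v => [|v] B0 vB; first by rewrite /bitlen trunc_log0.
rewrite /bitlen -(ltn_exp2l _ _ (ltnSn 1)).
by apply: leq_ltn_trans vB; apply: trunc_logP.
Qed.

Lemma ltn_bitlen v : v < 2 ^ bitlen v.
Proof. exact: trunc_log_ltn. Qed.

Definition bounded (B : nat) (s : state) : Prop :=
  [/\ 0 < B, forall i, regs s i < 2 ^ B & forall i, Defs.mem s i < 2 ^ B].

Lemma bounded_le B B' s : B <= B' -> bounded B s -> bounded B' s.
Proof.
move=> BB' [B0 rB mB]; split=> [|i|i]; first exact: leq_trans BB'.
  by apply: leq_trans (rB i) _; rewrite leq_exp2l.
by apply: leq_trans (mB i) _; rewrite leq_exp2l.
Qed.

(* One instruction at most doubles the largest number present, so [k]
   instructions cost at most [k] times the initial bit length plus [k], up to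
   constants; this reduces logarithmic cost to counting instructions. *)
Definition steps (p : prog) (s : state) (k : nat) (s' : state) : Prop :=
  forall B, bounded B s ->
  exists2 t, exec p s t s' & t <= k * (2 * (B + k) + 1) /\ bounded (B + k) s'.

Lemma steps_le p s k k' s' : k <= k' -> steps p s k s' -> steps p s k' s'.
Proof.
move=> kk' st B /st[t ex [tk bd]]; exists t => //; split.
  by apply: leq_trans tk _; apply: leq_mul => //; lia.
by apply: bounded_le bd; lia.
Qed.

Lemma bounded_set_reg B B' s x v :
  B <= B' -> v < 2 ^ B' -> bounded B s -> bounded B' (set_reg s x v).
Proof.
move=> BB' vB' /(bounded_le BB')[B0 rB mB]; split=> // i.
by rewrite /= /upd; case: eqP.
Qed.

Lemma steps_const s x c : steps (Const x c) s (1 + bitlen c) (set_reg s x c).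
Proof.
move=> B bd; exists (1 + bitlen c); first exact: exec_const.
split; first by nia.
apply: bounded_set_reg bd; first by lia.
by apply: leq_trans (ltn_bitlen c) _; rewrite leq_exp2l //; lia.
Qed.

Lemma steps_add s x y z :
  steps (Add x y z) s 1 (set_reg s x (regs s y + regs s z)).
Proof.
move=> B bd; have [B0 rB mB] := bd.
have [yB zB] := (bitlen_le B0 (rB y), bitlen_le B0 (rB z)).
exists (1 + bitlen (regs s y) + bitlen (regs s z)); first exact: exec_add.
split; first by lia.
apply: bounded_set_reg bd; first by lia.
by rewrite addn1 expnS mul2n -addnn -addSn leq_add // ltnW.
Qed.

Lemma steps_sub s x y z :
  steps (Defs.Sub x y z) s 1 (set_reg s x (regs s y - regs s z)).
Proof.
move=> B bd; have [B0 rB mB] := bd.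
have [yB zB] := (bitlen_le B0 (rB y), bitlen_le B0 (rB z)).
exists (1 + bitlen (regs s y) + bitlen (regs s z)); first exact: exec_sub.
split; first by lia.
apply: bounded_set_reg bd; first by lia.
apply: leq_ltn_trans (leq_subr _ _) (leq_trans (rB y) _).
by rewrite leq_exp2l //; lia.
Qed.

Lemma steps_fetch s x y :
  steps (Fetch x y) s 1 (set_reg s x (Defs.mem s (regs s y))).
Proof.
move=> B bd; have [B0 rB mB] := bd.
have [yB zB] := (bitlen_le B0 (rB y), bitlen_le B0 (mB (regs s y))).
eexists; first exact: exec_load.
split; first by lia.
apply: bounded_set_reg bd; first by lia.
by apply: leq_trans (mB _) _; rewrite leq_exp2l //; lia.
Qed.

Lemma steps_seq p q s1 s2 s3 k1 k2 :
  steps p s1 k1 s2 -> steps q s2 k2 s3 -> steps (Seq p q) s1 (k1 + k2) s3.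
Proof.
move=> st1 st2 B /st1[t1 ex1 [le1 /st2[t2 ex2 [le2 bd]]]].
exists (t1 + t2); first exact: exec_seq ex1 ex2.
split; last by rewrite addnA.
by rewrite mulnDl; apply: leq_add;
  [apply: leq_trans le1 _ | apply: leq_trans le2 _]; apply: leq_mul => //; lia.
Qed.

Lemma steps_if x p q s s' k :
  steps (if regs s x == 0 then q else p) s k s' -> steps (If x p q) s k.+1 s'.
Proof.
move=> st B bd; have [B0 rB mB] := bd; have [t ex [le1 bd']] := st B bd.
have xB := bitlen_le B0 (rB x).
exists (1 + bitlen (regs s x) + t).
  by case: eqP ex => x0 ex; [apply: exec_if_false | apply: exec_if_true => //; apply/eqP].
split; last by apply: bounded_le bd'; lia.
by apply: leq_trans (leq_add (leqnn _) le1) _; nia.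
Qed.

Lemma steps_while_false x p s : regs s x = 0 -> steps (While x p) s 1 s.
Proof.
move=> x0 B bd; have [B0 rB mB] := bd.
have xB := bitlen_le B0 (rB x).
eexists; first exact: exec_while_false.
by split; [lia | apply: bounded_le bd; lia].
Qed.

Lemma steps_while_true x p s1 s2 s3 k1 k2 : regs s1 x != 0 ->
  steps p s1 k1 s2 -> steps (While x p) s2 k2 s3 ->
  steps (While x p) s1 (k1 + k2).+1 s3.
Proof.
move=> x0 st1 st2 B bd; have [B0 rB mB] := bd.
have [t1 ex1 [le1 /st2[t2 ex2 [le2 bd']]]] := st1 B bd.
have xB := bitlen_le B0 (rB x).
eexists; first exact: exec_while_true ex1 ex2.
split; last by apply: bounded_le bd'; lia.
set X := 2 * (B + (k1 + k2).+1) + 1.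
have t1X : t1 <= k1 * X by apply: leq_trans le1 _; apply: leq_mul => //; lia.
have t2X : t2 <= k2 * X by apply: leq_trans le2 _; apply: leq_mul => //; lia.
have bX : 1 + bitlen (regs s1 x) <= X by lia.
by rewrite mulSn mulnDl -addnA leq_add // leq_add.
Qed.

(** * A language of loop expressions *)

(* [ERec b e1 e2] iterates [e2] from [e1]; variable 0 is the loop index and
   variable 1 the accumulator.  Loops run either [M[0]] times ([b = false]) or
   as many times as the parameter [EPar] says. *)
Inductive expr : Type :=
| EVar (i : nat)
| ENum (c : nat)
| EPar
| EAdd (e1 e2 : expr)
| ESub (e1 e2 : expr)
| EIn (e : expr)
| EIf (e1 e2 e3 : expr)
| ERec (b : bool) (e1 e2 : expr).

Definition scons (x : nat) (env : nat -> nat) : nat -> nat :=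
  fun i => if i is j.+1 then env j else x.

Definition bound (b : bool) (w : seq nat) (p : nat) : nat :=
  if b then p else nth 0 w 0.

Section Evaluation.
Variables (w : seq nat) (p : nat).

Fixpoint ev (e : expr) (env : nat -> nat) : nat :=
  match e with
  | EVar i => env i
  | ENum c => c
  | EPar => p
  | EAdd e1 e2 => ev e1 env + ev e2 env
  | ESub e1 e2 => ev e1 env - ev e2 env
  | EIn e => nth 0 w (ev e env)
  | EIf e1 e2 e3 => if ev e1 env != 0 then ev e2 env else ev e3 env
  | ERec b e1 e2 =>
      iteri (bound b w p) (fun k a => ev e2 (scons k (scons a env))) (ev e1 env)
  end.

Lemma eq_iteri T m (f g : nat -> T -> T) x :
  (forall k a, f k a = g k a) -> iteri m f x = iteri m g x.
Proof. by move=> fg; elim: m => //= m ->. Qed.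

Lemma eq_ev e env env' : env =1 env' -> ev e env = ev e env'.
Proof.
elim: e env env' => //= [e1 IH1 e2 IH2|e1 IH1 e2 IH2|e IH|e1 IH1 e2 IH2 e3 IH3
  |b e1 IH1 e2 IH2] env env' eq_env.
- by rewrite (IH1 _ _ eq_env) (IH2 _ _ eq_env).
- by rewrite (IH1 _ _ eq_env) (IH2 _ _ eq_env).
- by rewrite (IH _ _ eq_env).
- by rewrite (IH1 _ _ eq_env) (IH2 _ _ eq_env) (IH3 _ _ eq_env).
- rewrite (IH1 _ _ eq_env); apply: eq_iteri => k a.
  by apply: IH2 => -[|[|i]] /=.
Qed.

End Evaluation.

Fixpoint rename (e : expr) (r : nat -> nat) : expr :=
  match e with
  | EVar i => EVar (r i)
  | ENum c => ENum c
  | EPar => EPar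
  | EAdd e1 e2 => EAdd (rename e1 r) (rename e2 r)
  | ESub e1 e2 => ESub (rename e1 r) (rename e2 r)
  | EIn e => EIn (rename e r)
  | EIf e1 e2 e3 => EIf (rename e1 r) (rename e2 r) (rename e3 r)
  | ERec b e1 e2 =>
      ERec b (rename e1 r)
        (rename e2 (fun i => if i is j.+2 then (r j).+2 else i))
  end.

Lemma ev_rename w p e r env :
  ev w p (rename e r) env = ev w p e (fun i => env (r i)).
Proof.
elim: e r env => //= [e1 IH1 e2 IH2|e1 IH1 e2 IH2|e IH|e1 IH1 e2 IH2 e3 IH3
  |b e1 IH1 e2 IH2] r env; rewrite ?IH ?IH1 ?IH2 ?IH3 //.
by apply: eq_iteri => k a; rewrite IH2; apply: eq_ev => -[|[|i]].
Qed.

(* The value of [e] goes to register [h]; only registers from [h] on are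
   written.  Registers 0 and 1 hold [M[0]] and the parameter, and [r] gives the
   register of each variable. *)
Fixpoint compile (e : expr) (r : nat -> nat) (h : nat) : prog :=
  match e with
  | EVar i => Seq (Const h 0) (Add h (r i) h)
  | ENum c => Const h c
  | EPar => Seq (Const h 0) (Add h 1 h)
  | EAdd e1 e2 => Seq (compile e1 r h) (Seq (compile e2 r h.+1) (Add h h h.+1))
  | ESub e1 e2 => Seq (compile e1 r h) (Seq (compile e2 r h.+1) (Defs.Sub h h h.+1))
  | EIn e => Seq (compile e r h) (Fetch h h)
  | EIf e1 e2 e3 => Seq (compile e1 r h) (If h (compile e2 r h) (compile e3 r h))
  | ERec b e1 e2 =>
      Seq (compile e1 r h) (Seq (Const h.+1 0) (Seq (Defs.Sub h.+2 b h.+1)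
        (While h.+2 (Seq (compile e2 (scons h.+1 (scons h r)) h.+2)
          (Seq (Const h.+3 0) (Seq (Add h h.+2 h.+3) (Seq (Const h.+3 1)
            (Seq (Add h.+1 h.+1 h.+3) (Defs.Sub h.+2 b h.+1)))))))))
  end.

(** A state-independent bound: a conditional pays for both branches, and [m] is any number that
    bounds the turns of both kinds of loop. *)
Fixpoint cost (e : expr) (m : nat) : nat :=
  match e with
  | EVar i => 3
  | ENum c => 1 + bitlen c
  | EPar => 3
  | EAdd e1 e2 => cost e1 m + (cost e2 m + 1)
  | ESub e1 e2 => cost e1 m + (cost e2 m + 1)
  | EIn e => cost e m + 1
  | EIf e1 e2 e3 => cost e1 m + (cost e2 m + cost e3 m).+1
  | ERec b e1 e2 => cost e1 m + (m * (cost e2 m + 8) + 4)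
  end.

(** Degrees are added at every combination, and each loop raises the degree by one more. *)
Lemma cost_poly e : exists K d, forall m, cost e m <= K * m.+1 ^ d.
Proof.
have step K1 d1 K2 d2 m c1 c2 : c1 <= K1 * m.+1 ^ d1 -> c2 <= K2 * m.+1 ^ d2 ->
    c1 + c2 + 1 <= (K1 + K2 + 1) * m.+1 ^ (d1 + d2).
  move=> le1 le2.
  have le_l : m.+1 ^ d1 <= m.+1 ^ (d1 + d2) by rewrite leq_pexp2l ?leq_addr.
  have le_r : m.+1 ^ d2 <= m.+1 ^ (d1 + d2) by rewrite leq_pexp2l ?leq_addl.
  have gt0 : 0 < m.+1 ^ (d1 + d2) by rewrite expn_gt0.
  by nia.
elim: e => [i|c||e1 [K1 [d1 H1]] e2 [K2 [d2 H2]]|e1 [K1 [d1 H1]] e2 [K2 [d2 H2]]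
  |e [K [d H]]|e1 [K1 [d1 H1]] e2 [K2 [d2 H2]] e3 [K3 [d3 H3]]
  |b e1 [K1 [d1 H1]] e2 [K2 [d2 H2]]].
- by exists 3, 0 => m; rewrite muln1.
- by exists (1 + bitlen c), 0 => m; rewrite muln1.
- by exists 3, 0 => m; rewrite muln1.
- by exists (K1 + K2 + 1), (d1 + d2) => m /=; rewrite addnA step.
- by exists (K1 + K2 + 1), (d1 + d2) => m /=; rewrite addnA step.
- exists (K + 0 + 1), (d + 0) => m /=; rewrite -[cost e m]addn0.
  by apply: step (H m) _.
- exists (K1 + (K2 + K3 + 1) + 1), (d1 + (d2 + d3)) => m /=.
  have := step _ _ _ _ _ _ _ (H1 m) (step _ _ _ _ _ _ _ (H2 m) (H3 m)).
  by apply: leq_trans; lia.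
- exists (K1 + (K2 + 12) + 1), (d1 + d2.+1) => m /=.
  have le2 : m * (cost e2 m + 8) + 4 <= (K2 + 12) * m.+1 ^ d2.+1.
    have gt0 : 0 < m.+1 ^ d2 by rewrite expn_gt0.
    have h : cost e2 m + 8 <= (K2 + 8) * m.+1 ^ d2 by have := H2 m; nia.
    have h2 : m * (cost e2 m + 8) <= m.+1 * ((K2 + 8) * m.+1 ^ d2).
      by apply: leq_mul.
    by rewrite expnS; nia.
  by have := step _ _ _ _ _ _ _ (H1 m) le2; apply: leq_trans; lia.
Qed.

Definition set_regE s x v y :
  regs (set_reg s x v) y = if y == x then v else regs s y := erefl.

Ltac get_reg := rewrite !set_regE; repeat first [rewrite eqxx |
  match goal with |- context [?a == ?b] =>
    rewrite (_ : (a == b) = false); [|by lia] end].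

Section Compilation.
Variables (w : seq nat) (p : nat).

Definition ready (s : state) : Prop :=
  [/\ regs s 0 = nth 0 w 0, regs s 1 = p & Defs.mem s = nth 0 w].

Definition frame (h : nat) (s s' : state) : Prop :=
  (forall j, j < h -> regs s' j = regs s j) /\ Defs.mem s' = Defs.mem s.

Lemma frame_ready h s s' : 1 < h -> frame h s s' -> ready s -> ready s'.
Proof. by move=> h1 [rE mE] [s0 s1 sm]; split; rewrite ?rE ?mE // ltnW. Qed.

Lemma frame_trans h s1 s2 s3 : frame h s1 s2 -> frame h s2 s3 -> frame h s1 s3.
Proof.
move=> [r12 m12] [r23 m23]; split; last by rewrite m23.
by move=> j jh; rewrite r23 ?r12.
Qed.

Lemma frame_le h h' s s' : h <= h' -> frame h' s s' -> frame h s s'.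
Proof. by move=> hh' [rE mE]; split=> // j jh; apply: rE; apply: leq_trans hh'. Qed.

Lemma frame_set_reg h s x v : h <= x -> frame h s (set_reg s x v).
Proof.
move=> hx; split=> // j jh; rewrite set_regE; case: eqP => // jx.
by move: jh; rewrite jx ltnNge hx.
Qed.

Lemma compile_ok e r h env s : 1 < h -> (forall i, r i < h) -> ready s ->
  (forall i, regs s (r i) = env i) ->
  exists s', [/\ steps (compile e r h) s (cost e (nth 0 w 0 + p)) s',
                 regs s' h = ev w p e env & frame h s s'].
Proof.
set N := nth 0 w 0 + p.
elim: e r h env s => [i|c||e1 IH1 e2 IH2|e1 IH1 e2 IH2|e IH
  |e1 IH1 e2 IH2 e3 IH3|b e1 IH1 e2 IH2] r h env s h1 rh rs renv.
- eexists; split.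
  + by apply: (steps_seq (k1 := 2)); [apply: steps_const|apply: steps_add].
  + by rewrite !set_regE eqxx (ltn_eqF (rh i)) addn0 renv.
  + by apply: (frame_trans (s2 := set_reg s h 0)); apply: frame_set_reg.
- exists (set_reg s h c); split; first exact: steps_const.
  + by rewrite set_regE eqxx.
  + exact: frame_set_reg.
- eexists; split.
  + by apply: (steps_seq (k1 := 2)); [apply: steps_const|apply: steps_add].
  + by rewrite !set_regE eqxx (ltn_eqF h1) addn0; case: rs.
  + by apply: (frame_trans (s2 := set_reg s h 0)); apply: frame_set_reg.
- have [s1 [st1 v1 f1]] := IH1 r h env s h1 rh rs renv.
  have [||||s2 [st2 v2 f2]] := IH2 r h.+1 env s1; first exact: ltnW.
  + by move=> i; apply: leqW.
  + exact: frame_ready f1 rs.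
  + by move=> i; case: f1 => -> //.
  eexists; split.
  + apply: steps_seq st1 _; apply: steps_seq st2 _; exact: steps_add.
  + by rewrite set_regE eqxx v2 /= -v1; case: f2 => ->.
  + apply: frame_trans f1 _; apply: frame_trans (frame_le (leqnSn h) f2) _.
    exact: frame_set_reg.
- have [s1 [st1 v1 f1]] := IH1 r h env s h1 rh rs renv.
  have [||||s2 [st2 v2 f2]] := IH2 r h.+1 env s1; first exact: ltnW.
  + by move=> i; apply: leqW.
  + exact: frame_ready f1 rs.
  + by move=> i; case: f1 => -> //.
  eexists; split.
  + apply: steps_seq st1 _; apply: steps_seq st2 _; exact: steps_sub.
  + by rewrite set_regE eqxx v2 /= -v1; case: f2 => ->.
  + apply: frame_trans f1 _; apply: frame_trans (frame_le (leqnSn h) f2) _.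
    exact: frame_set_reg.
- have [s1 [st1 v1 f1]] := IH r h env s h1 rh rs renv.
  eexists; split.
  + by apply: steps_seq st1 _; apply: steps_fetch.
  + by rewrite set_regE eqxx v1 /=; case: (frame_ready h1 f1 rs) => _ _ ->.
  + by apply: frame_trans f1 _; apply: frame_set_reg.
- have [s1 [st1 v1 f1]] := IH1 r h env s h1 rh rs renv.
  have [||s2 [st2 v2 f2]] := IH2 r h env s1 h1 rh.
  + exact: frame_ready f1 rs.
  + by move=> i; case: f1 => -> //.
  have [||s3 [st3 v3 f3]] := IH3 r h env s1 h1 rh.
  + exact: frame_ready f1 rs.
  + by move=> i; case: f1 => -> //.
  exists (if ev w p e1 env == 0 then s3 else s2); split.
  + apply: steps_seq st1 _; apply: steps_if; rewrite v1.
    by case: eqP => _; [apply: steps_le st3 | apply: steps_le st2];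
      rewrite ?leq_addl ?leq_addr.
  + by rewrite /=; case: eqP.
  + by apply: frame_trans f1 _; case: eqP.
- have [s1 [st1 v1 f1]] := IH1 r h env s h1 rh rs renv.
  set F := fun k a => ev w p e2 (scons k (scons a env)).
  set m := bound b w p.
  have bE s' : ready s' -> regs s' b = m by rewrite /m; case: (b) => -[].
  have bh : b < h by apply: leq_trans h1; case: (b).
  pose body := Seq (compile e2 (scons h.+1 (scons h r)) h.+2)
          (Seq (Const h.+3 0) (Seq (Add h h.+2 h.+3) (Seq (Const h.+3 1)
            (Seq (Add h.+1 h.+1 h.+3) (Defs.Sub h.+2 b h.+1))))).
  (* After [k] turns, [h] holds the accumulator, [h.+1] the index and [h.+2] the number of turns
     left, which is the loop test. *)
  pose inv k s' := [/\ regs s' h = iteri k F (ev w p e1 env), regs s' h.+1 = k,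
    regs s' h.+2 = m - k & frame h s s'].
  have iterate k s' : inv k s' ->
      exists2 s'', steps body s' (cost e2 N + 7) s'' & inv k.+1 s''.
    move=> [acc idx cnd fr].
    have rs' := frame_ready h1 fr rs.
    have [||||s2 [st2 v2 f2]] :=
        IH2 (scons h.+1 (scons h r)) h.+2 (scons k (scons (regs s' h) env)) s'.
    + by rewrite ltnW // ltnW.
    + by move=> [|[|i]] /=; try have := rh i; lia.
    + exact: rs'.
    + by move=> [|[|i]] //=; case: fr => ->.
    have [f2r f2m] := f2.
    eexists.
      rewrite /body (_ : _ + 7 = cost e2 N + (2 + (1 + (2 + (1 + 1))))) //.
      apply: steps_seq st2 _; apply: steps_seq; first exact: steps_const.
      apply: steps_seq; first exact: steps_add.
      apply: steps_seq; first exact: steps_const.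
      apply: steps_seq; first exact: steps_add.
      exact: steps_sub.
    have frm : frame h s s2 by apply: frame_trans fr (frame_le _ f2); lia.
    have rs2 := frame_ready h1 frm rs.
    split.
    + by get_reg; rewrite addn0 v2 acc.
    + by get_reg; rewrite f2r // idx addn1.
    + by get_reg; rewrite (bE _ rs2) f2r // idx addn1.
    + apply: frame_trans frm _.
      do 5![apply: frame_trans; last by apply: frame_set_reg; lia].
      by split.
  have loop k j s' : inv j s' -> j + k = m ->
      exists2 s'', steps (While h.+2 body) s' (k * (cost e2 N + 8) + 1) s'' & inv m s''.
    elim: k j s' => [|k IHk] j s' invj jk.
      move: jk; rewrite addn0 => jm; subst j; exists s' => //.
      by apply: steps_while_false; case: invj => _ _ -> _; rewrite subnn.
    have [s2 st2 inv2] := iterate _ _ invj.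
    have [|s3 st3 inv3] := IHk _ _ inv2; first by rewrite addSnnS.
    exists s3 => //.
    have -> : k.+1 * (cost e2 N + 8) + 1 =
       ((cost e2 N + 7) + (k * (cost e2 N + 8) + 1)).+1 by rewrite mulSn; lia.
    apply: steps_while_true st2 st3.
    by case: invj => _ _ -> _; rewrite -jk addKn.
  pose s2 := set_reg s1 h.+1 0.
  pose s3 := set_reg s2 h.+2 (regs s2 b - regs s2 h.+1).
  have inv0 : inv 0 s3.
    split.
    + by get_reg.
    + by get_reg.
    + by get_reg; rewrite bE //; apply: frame_ready f1 rs.
    + by apply: frame_trans f1 _; apply: (frame_trans (s2 := s2)); apply: frame_set_reg; lia.
  have [s4 st4 [acc _ _ fr]] := loop m 0 s3 inv0 (add0n m).
  exists s4; split=> //.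
  apply: (@steps_le _ _ (cost e1 N + (2 + (1 + (m * (cost e2 N + 8) + 1))))).
    rewrite /= leq_add2l; have: m <= N by rewrite /m /N; case: (b) => /=; lia.
    by move=> mN; have := leq_mul mN (leqnn (cost e2 N + 8)); lia.
  apply: steps_seq st1 _; apply: steps_seq; first exact: steps_const.
  by apply: steps_seq; [apply: steps_sub | apply: st4].
Qed.

End Compilation.

(** Register 1 is still 0 while [e1] runs, so the first phase sees parameter 0; its result then
    becomes the parameter of [e2]. *)
Definition two_phase (e1 e2 : expr) : prog :=
  Seq (Fetch 0 0) (Seq (compile e1 (fun=> 0) 2) (Seq (Const 3 0) (Seq (Add 1 2 3)
    (Seq (compile e2 (fun=> 0) 2) (Seq (Const 3 0) (Add 0 2 3)))))).

Lemma leq_expl m n e : m <= n -> m ^ e <= n ^ e.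
Proof. by case: e => // e mn; rewrite leq_exp2r. Qed.

Lemma bounded_init w : bounded (input_size w).+1 (init w).
Proof.
split=> // i; first by rewrite expn_gt0.
rewrite /=; have [iw|wi] := ltnP i (size w); last by rewrite nth_default ?expn_gt0.
apply: leq_trans (ltn_bitlen _) _; rewrite leq_exp2l // ltnW // ltnS.
by rewrite /input_size (big_rem (nth 0 w i)) ?mem_nth //= leq_addr.
Qed.

Lemma two_phase_ok e1 e2 : exists K d, forall w,
  let n := nth 0 w 0 in let p := ev w 0 e1 (fun=> n) in
  exists2 t, runs (two_phase e1 e2) w t (ev w p e2 (fun=> n)) &
    t <= K * (n + p + input_size w).+1 ^ d.
Proof.
have [K1 [d1 cost1]] := cost_poly e1; have [K2 [d2 cost2]] := cost_poly e2.
pose K0 := K1 + K2 + 9.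
(* With [Y = n + p + input_size w + 1] and [d0 = d1 + d2], the count [k] is at most [K0 * Y ^ d0]
   and the initial bit length [B] at most [Y], so [2 * (B + k) + 1] is at most
   [(2 * K0 + 3) * Y ^ (d0 + 1)]. *)
exists (K0 * (2 * K0 + 3)), (d1 + d2 + (1 + (d1 + d2))) => w n p.
pose s1 := set_reg (init w) 0 n.
have rs1 : ready w 0 s1 by [].
have [||||s2 [st2 v2 f2]] := @compile_ok w 0 e1 (fun=> 0) 2 (fun=> n) s1 => //.
have rs2 := frame_ready (ltnSn 1) f2 rs1.
pose s3 := set_reg s2 3 0; pose s4 := set_reg s3 1 (regs s3 2 + regs s3 3).
have rs4 : ready w p s4.
  by case: rs2 => r0 r1 rm; split=> //; rewrite /s4 /= /upd /= v2 addn0.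
have r40 : regs s4 0 = n by case: rs4.
have [||||s5 [st5 v5 f5]] := @compile_ok w p e2 (fun=> 0) 2 (fun=> n) s4 => //.
pose s6 := set_reg s5 3 0; pose s7 := set_reg s6 0 (regs s6 2 + regs s6 3).
have st : steps (two_phase e1 e2) (init w)
    (1 + (cost e1 (n + 0) + (2 + (1 + (cost e2 (n + p) + (2 + 1)))))) s7.
  apply: steps_seq; first exact: steps_fetch.
  apply: steps_seq st2 _; apply: steps_seq; first exact: steps_const.
  apply: steps_seq; first exact: steps_add.
  apply: steps_seq st5 _; apply: steps_seq; first exact: steps_const.
  exact: steps_add.
set Y := (n + p + input_size w).+1; set d0 := d1 + d2.
have stT : steps (two_phase e1 e2) (init w) (K0 * Y ^ d0) s7.
  apply: steps_le st.
  have le1 : cost e1 (n + 0) <= K1 * Y ^ d0.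
    apply: leq_trans (cost1 _) (leq_mul (leqnn _) _).
    apply: (@leq_trans (Y ^ d1)); last by rewrite leq_pexp2l ?leq_addr.
    by apply: leq_expl; lia.
  have le2 : cost e2 (n + p) <= K2 * Y ^ d0.
    apply: leq_trans (cost2 _) (leq_mul (leqnn _) _).
    apply: (@leq_trans (Y ^ d2)); last by rewrite leq_pexp2l ?leq_addl.
    by apply: leq_expl; lia.
  have gt0 : 0 < Y ^ d0 by rewrite expn_gt0.
  by rewrite /K0; nia.
have [t ex [le_t _]] := stT _ (bounded_init w).
exists t; first by exists s7 => //; rewrite /s7 /= /upd /= v5 addn0.
apply: leq_trans le_t _; rewrite expnD -!mulnA leq_mul2l; apply/orP; right.
rewrite mulnCA leq_mul2l; apply/orP; right; rewrite expnS.
have gt0 : 0 < Y ^ d0 by rewrite expn_gt0.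
have : input_size w < Y by rewrite /Y; lia.
by rewrite -/d0; nia.
Qed.

(** * Functions computed by loop expressions *)

Definition context_fun : Type := seq nat -> nat -> (nat -> nat) -> nat.

(** Hides the syntax of expressions, so that the program is obtained from closure properties; [env]
    is a de Bruijn environment. *)
Definition definable (F : context_fun) : Prop :=
  exists e, forall w p env, ev w p e env = F w p env.

Lemma def_ext F F' : definable F -> (forall w p env, F w p env = F' w p env) ->
  definable F'.
Proof. by move=> [e eE] FF'; exists e => w p env; rewrite eE. Qed.

Lemma def_var i : definable (fun _ _ env => env i).
Proof. by exists (EVar i). Qed.

Lemma def_num c : definable (fun _ _ _ => c).
Proof. by exists (ENum c). Qed.

Lemma def_par : definable (fun _ p _ => p).
Proof. by exists EPar. Qed.

Lemma def_in F : definable F -> definable (fun w p env => nth 0 w (F w p env)).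
Proof. by move=> [e eE]; exists (EIn e) => w p env; rewrite /= eE. Qed.

Lemma def_add F G : definable F -> definable G ->
  definable (fun w p env => F w p env + G w p env).
Proof. by move=> [e eE] [f fE]; exists (EAdd e f) => w p env; rewrite /= eE fE. Qed.

Lemma def_sub F G : definable F -> definable G ->
  definable (fun w p env => F w p env - G w p env).
Proof. by move=> [e eE] [f fE]; exists (ESub e f) => w p env; rewrite /= eE fE. Qed.

Lemma def_if C F G : definable (fun w p env => C w p env : bool) ->
  definable F -> definable G ->
  definable (fun w p env => if C w p env then F w p env else G w p env).
Proof.
move=> [c cE] [e eE] [f fE]; exists (EIf c e f) => w p env.
by rewrite /= cE eE fE; case: (C w p env).
Qed.

(** Moves a function of the outer variables under loop binders, [r] being the shift of indices. *)
Lemma def_ren (r : nat -> nat) F : definable F ->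
  definable (fun w p env => F w p (fun i => env (r i))).
Proof. by move=> [e eE]; exists (rename e r) => w p env; rewrite ev_rename. Qed.

Lemma def_iter b F (H : seq nat -> nat -> nat -> nat -> (nat -> nat) -> nat) :
  definable F ->
  definable (fun w p env => H w p (env 0) (env 1) (fun i => env i.+2)) ->
  definable (fun w p env =>
    iteri (bound b w p) (fun k a => H w p k a env) (F w p env)).
Proof.
move=> [e eE] [f fE]; exists (ERec b e f) => w p env.
by rewrite /= eE; apply: eq_iteri => k a; rewrite fE.
Qed.

Lemma iteri_sum m (f : nat -> nat) :
  iteri m (fun k a => a + f k) 0 = \sum_(k < m) f k.
Proof. by elim: m => [|m IHm]; rewrite ?big_ord0 // big_ord_recr /= IHm. Qed.

Lemma def_sum b (H : seq nat -> nat -> nat -> (nat -> nat) -> nat) :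
  definable (fun w p env => H w p (env 0) (fun i => env i.+1)) ->
  definable (fun w p env => \sum_(k < bound b w p) H w p k env).
Proof.
move=> dH; apply: def_ext (fun w p env => iteri_sum (bound b w p) (fun k => H w p k env)).
apply: (@def_iter _ (fun _ _ _ => 0) (fun w p k a env => a + H w p k env)).
  exact: def_num.
apply: def_add; first exact: def_var.
exact: (def_ren (fun i => if i is j.+1 then j.+2 else 0) dH).
Qed.

Lemma def_not P : definable (fun w p env => P w p env : bool) ->
  definable (fun w p env => ~~ P w p env).
Proof.
move=> dP; apply: def_ext (def_if dP (def_num 0) (def_num 1)) _ => w p env.
by case: (P w p env).
Qed.

Lemma def_and P Q : definable (fun w p env => P w p env : bool) ->
  definable (fun w p env => Q w p env : bool) ->
  definable (fun w p env => P w p env && Q w p env).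
Proof.
move=> dP dQ; apply: def_ext (def_if dP dQ (def_num 0)) _ => w p env.
by case: (P w p env).
Qed.

Lemma def_or P Q : definable (fun w p env => P w p env : bool) ->
  definable (fun w p env => Q w p env : bool) ->
  definable (fun w p env => P w p env || Q w p env).
Proof.
move=> dP dQ; apply: def_ext (def_if dP (def_num 1) dQ) _ => w p env.
by case: (P w p env).
Qed.

Lemma def_leq F G : definable F -> definable G ->
  definable (fun w p env => F w p env <= G w p env).
Proof.
move=> [e eE] [f fE]; exists (EIf (ESub e f) (ENum 0) (ENum 1)) => w p env.
by rewrite /= eE fE subn_eq0; case: leq.
Qed.

Lemma def_eq F G : definable F -> definable G ->
  definable (fun w p env => F w p env == G w p env).
Proof.
move=> dF dG; apply: def_ext (def_and (def_leq dF dG) (def_leq dG dF)) _.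
by move=> w p env; rewrite eqn_leq.
Qed.

Lemma has_iota P m : has P (iota 0 m) = (0 < \sum_(k < m) P k).
Proof.
rewrite lt0n sum_nat_eq0; apply/hasP/forallPn => [[k]|[k]] /=.
  by rewrite mem_iota => km Pk; exists (Ordinal km); rewrite Pk.
by rewrite eqb0 negbK => Pk; exists k => //; rewrite mem_iota /=.
Qed.

Lemma def_has b (P : seq nat -> nat -> nat -> (nat -> nat) -> bool) :
  definable (fun w p env => P w p (env 0) (fun i => env i.+1)) ->
  definable (fun w p env => has (fun k => P w p k env) (iota 0 (bound b w p))).
Proof.
move=> dP; apply: def_ext (fun w p env =>
  congr1 nat_of_bool (esym (has_iota (fun k => P w p k env) (bound b w p)))).
apply: def_leq; first exact: def_num.
exact: (@def_sum b (fun w p k env => P w p k env)).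
Qed.

Lemma def_all b (P : seq nat -> nat -> nat -> (nat -> nat) -> bool) :
  definable (fun w p env => P w p (env 0) (fun i => env i.+1)) ->
  definable (fun w p env => all (fun k => P w p k env) (iota 0 (bound b w p))).
Proof.
move=> /def_not dP.
apply: def_ext (def_not (def_has b (P := fun w p k env => ~~ P w p k env) dP)) _.
by move=> w p env; rewrite has_predC negbK.
Qed.

Lemma def_mul_bound b F : definable F ->
  definable (fun w p env => F w p env * bound b w p).
Proof.
move=> dF; apply: def_ext (def_sum b (H := fun w p _ env => F w p env) _) _.
  exact: (def_ren S dF).
by move=> w p env; rewrite sum_nat_const card_ord mulnC.
Qed.

Lemma sum_ltn m k c : \sum_(j < m) (if j < k then c else 0) = c * minn k m.
Proof.
elim: m => [|m IHm]; first by rewrite big_ord0 minn0 muln0.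
rewrite big_ord_recr /= IHm; case: (boolP (m < k)) => mk; rewrite ?addn0 -?mulnSr;
  by congr (_ * _); lia.
Qed.

(** Products are repeated additions in a loop of fixed length whose turns past [G] add nothing;
    hence the cap on [G]. *)
Lemma def_mul b F G : definable F -> definable G ->
  definable (fun w p env => F w p env * minn (G w p env) (bound b w p)).
Proof.
move=> dF dG; apply: def_ext (fun w p env => sum_ltn (bound b w p) (G w p env) (F w p env)).
apply: (@def_sum b (fun w p j env => if j < G w p env then F w p env else 0)).
apply: def_if; [apply: def_leq|exact: (def_ren S dF)|exact: def_num].
  by apply: (@def_add (fun _ _ _ => 1)); [apply: def_num|apply: def_var].
exact: (def_ren S dG).
Qed.

Lemma iteri_pow2 m k c :
  iteri m (fun j a => if j < k then a + a else a) c = c * 2 ^ minn k m.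
Proof.
elim: m => [|m IHm]; first by rewrite minn0 muln1.
rewrite /= IHm; case: (boolP (m < k)) => mk.
  have -> : minn k m.+1 = (minn k m).+1 by lia.
  by rewrite expnS mulnCA mul2n addnn.
by congr (_ * 2 ^ _); lia.
Qed.

Lemma def_pow2 b F : definable F ->
  definable (fun w p env => 2 ^ minn (F w p env) (bound b w p)).
Proof.
move=> dF; apply: def_ext (fun w p env =>
  etrans (iteri_pow2 (bound b w p) (F w p env) 1) (mul1n _)).
apply: (@def_iter b (fun _ _ _ => 1)
  (fun w p j a env => if j < F w p env then a + a else a)); first exact: def_num.
apply: def_if; [apply: def_leq|apply: def_add; apply: def_var|apply: def_var].
  by apply: (@def_add (fun _ _ _ => 1)); [apply: def_num|apply: def_var].
exact: (def_ren (fun i => i.+2) dF).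
Qed.

Lemma iteri_exp x m k c :
  iteri m (fun j a => if j < k then a * x else a) c = c * x ^ minn k m.
Proof.
elim: m => [|m IHm]; first by rewrite minn0 muln1.
rewrite /= IHm; case: (boolP (m < k)) => mk.
  have -> : minn k m.+1 = (minn k m).+1 by lia.
  by rewrite expnSr mulnA.
by congr (_ * _ ^ _); lia.
Qed.

Lemma def_ltn F G : definable F -> definable G ->
  definable (fun w p env => F w p env < G w p env).
Proof. by move=> dF; apply: def_leq; apply: (def_add (def_num 1) dF). Qed.

(** The squared exponent may exceed the loop bound, so loops are nested: the inner one multiplies by
    [2 ^ x], and it is performed [x] times. *)
Lemma def_pow2_sq b F : definable F ->
  definable (fun w p env =>
    2 ^ (minn (F w p env) (bound b w p) * minn (F w p env) (bound b w p))).
Proof.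
move=> dF.
apply: (@def_ext (fun w p env => iteri (bound b w p) (fun i a =>
    if i < F w p env then
      iteri (bound b w p) (fun j c => if j < F w p env then c + c else c) a
    else a) 1)).
  apply: (@def_iter b (fun _ _ _ => 1) (fun w p i a env =>
    if i < F w p env then
      iteri (bound b w p) (fun j c => if j < F w p env then c + c else c) a
    else a)); first exact: def_num.
  have dF2 := def_ren (fun i => i.+2) dF.
  apply: def_if; [apply: def_ltn (def_var 0) dF2 | | exact: def_var].
  apply: (@def_iter b (fun _ _ env => env 1) (fun w p j c env =>
    if j < F w p (fun i => env i.+2) then c + c else c)); first exact: def_var.
  apply: def_if; last exact: def_var.
    exact: def_ltn (def_var 0) (def_ren (fun i => i.+2) dF2).
  exact: def_add (def_var 1) (def_var 1).
move=> w p env; rewrite expnM -[RHS]mul1n -iteri_exp; apply: eq_iteri => i a.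
by rewrite iteri_pow2.
Qed.

(* Sets of numbers below [m] are stored as numbers below [2 ^ m]; a member is
   looked up by first removing the bits above it, from the top. *)
Definition low (m z v : nat) : nat :=
  iteri m (fun k a =>
    if (v < m - k.+1) && (2 ^ minn (m - k.+1) m <= a)
    then a - 2 ^ minn (m - k.+1) m else a) z.

Definition bit (m z v : nat) : bool := 2 ^ minn v m <= low m z v.

Lemma bitE m z v : v < m -> z < 2 ^ m -> bit m z v = odd (z %/ 2 ^ v).
Proof.
move=> vm zm; suff lowE : low m z v = z %% 2 ^ v.+1.
  rewrite /bit lowE (minn_idPl (ltnW vm)) -[LHS]lt0b.
  have v0 : 0 < 2 ^ v by rewrite expn_gt0.
  have : (z %% 2 ^ v.+1) %/ 2 ^ v = odd (z %/ 2 ^ v).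
    by rewrite expnS -modn_divl modn2.
  by case: odd => E; [move: (leq_divRL 1 (z %% 2 ^ v.+1) v0)|
    move: (leq_divRL 1 (z %% 2 ^ v.+1) v0)]; rewrite E mul1n => <-.
pose f k a := if (v < m - k.+1) && (2 ^ minn (m - k.+1) m <= a)
    then a - 2 ^ minn (m - k.+1) m else a.
(* After [k] turns exactly the bits from position [maxn v.+1 (m - k)] on are gone. *)
suff lowk k : k <= m -> iteri k f z = z %% 2 ^ maxn v.+1 (m - k).
  by rewrite /low lowk // subnn maxn0.
elim: k => [_|k IHk km]; first by rewrite subn0 (maxn_idPr vm) modn_small.
rewrite /= IHk ?(ltnW km) // /f.
set j := m - k.+1; have -> : m - k = j.+1 by lia.
have -> : minn j m = j by lia.
case: (ltnP v j) => vj /=; last by have -> : maxn v.+1 j.+1 = maxn v.+1 j by lia.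
have -> : maxn v.+1 j.+1 = j.+1 by lia.
have -> : maxn v.+1 j = j by lia.
have j0 : 0 < 2 ^ j by rewrite expn_gt0.
rewrite -(modn_dvdm z (dvdn_exp2l 2 (leqnSn j))).
have : z %% 2 ^ j.+1 < 2 ^ j.+1 by rewrite ltn_mod expn_gt0.
move: (z %% _) => y; rewrite expnS mul2n -addnn => lt_y.
case: leqP => le_y; last by rewrite modn_small.
rewrite -{2}(subnK le_y) modnDr modn_small //; lia.
Qed.

Lemma def_bit b F G : definable F -> definable G ->
  definable (fun w p env => bit (bound b w p) (F w p env) (G w p env)).
Proof.
move=> dF dG; apply: def_leq; first exact: def_pow2.
have def_bound : definable (fun w p _ => bound b w p).
  by case: b; [apply: def_par | apply: def_in (def_num 0)].
apply: (@def_iter b F (fun w p k a env =>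
    if (G w p env < bound b w p - k.+1) &&
       (2 ^ minn (bound b w p - k.+1) (bound b w p) <= a)
    then a - 2 ^ minn (bound b w p - k.+1) (bound b w p) else a)) => //.
have dj : definable (fun w p env => bound b w p - (env 0).+1).
  exact: def_sub def_bound (def_add (def_num 1) (def_var 0)).
have dq := def_pow2 b dj.
apply: def_if; [|exact: def_sub (def_var 1) dq|exact: def_var].
apply: def_and; last exact: def_leq dq (def_var 1).
exact: def_ltn (def_ren (fun i => i.+2) dG) dj.
Qed.

(** The [minn] changes nothing for [x < m]; it gives the power the form that [def_pow2] computes. *)
Definition bitset (m : nat) (P : nat -> bool) : nat :=
  \sum_(x < m) (if P x then 2 ^ minn x m else 0).

Lemma bitsetE m P : bitset m P = \sum_(x < m) P x * 2 ^ x.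
Proof.
apply: eq_bigr => x _; rewrite (minn_idPl (ltnW (ltn_ord x))).
by case: (P x); rewrite ?mul1n.
Qed.

Lemma bitset_lt m P : bitset m P < 2 ^ m.
Proof.
rewrite bitsetE; elim: m => [|m IHm]; first by rewrite big_ord0.
rewrite big_ord_recr /= expnS mul2n -addnn -addSn leq_add //.
by case: (P m); rewrite ?mul1n ?mul0n.
Qed.

Lemma bit_bitset m P v : v < m -> bit m (bitset m P) v = P v.
Proof.
move=> vm; rewrite bitE ?bitset_lt // bitsetE.
elim: m P v vm => // m IHm P v vm; rewrite big_ord_recl muln1.
under eq_bigr do rewrite /= /bump /= add1n expnS mulnCA.
rewrite -big_distrr; case: v vm => [_|v vm].
  by rewrite divn1 oddD oddM /= addbF oddb.
have <- := IHm (fun x => P x.+1) v vm.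
rewrite expnS divnMA; congr (odd (_ %/ _)).
rewrite /= addnC mulnC divnMDl // divn_small ?addn0 //; by case: (P _).
Qed.

(** * The algorithm *)

Section Algorithm.
Variable w : seq nat.

Definition dim : nat := nth 0 w 0.

Definition adjw (i j : nat) : bool := nth 0 w (1 + (i * dim + j)) != 0.

Definition valw (i : nat) : nat := nth 0 w (1 + (dim * dim + i)).

(* Such [u] and [v] get the same label: compare the sums around [a] and [b]. *)
Definition relw (u v : nat) : bool :=
  has (fun a => has (fun b =>
    all (fun x => adjw a x + (x == v) == adjw b x + (x == u)) (iota 0 dim))
    (iota 0 dim)) (iota 0 dim).

(** Breadth-first closure under [relw], starting from the code of the singleton of [v]. *)
Definition reachw (v : nat) : nat :=
  iteri dim (fun _ z =>
    bitset dim (fun x => has (fun u => bit dim z u && relw u x) (iota 0 dim)))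
    (2 ^ minn v dim).

Definition repw (l : nat) : bool :=
  ~~ has (fun u => (u < l) && bit dim (reachw l) u) (iota 0 dim).

Definition firstw (i : nat) : bool :=
  ~~ has (fun j => (j < i) && (valw j == valw i)) (iota 0 dim).

(** Numbers the members of [P] consecutively from 0; this supplies the row and column indices of the
    guessed matrix. *)
Definition rank (P : pred nat) (m i : nat) : nat :=
  \sum_(j < m) ((j < i) && P j).

Definition nb_rep : nat := \sum_(l < dim) repw l.

(** In a regular graph vertex 0 decides whether there is any edge. *)
Definition isolated : bool := all (fun x => ~~ adjw 0 x) (iota 0 dim).

(** Edgeless graphs get no search: there every vertex is its own class while [fvs] is 0, so the
    number of guesses would not be bounded in terms of [fvs]. *)
Definition nb_guess : nat :=
  if isolated then 0 else 2 ^ (minn nb_rep dim * minn nb_rep dim).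

(* The guess [t] is a matrix of bits, one row for each class (represented by its
   least vertex) and one column for each distinct value of [S]. *)
Definition cand (p t v : nat) : nat :=
  \sum_(l < dim) if repw l && bit dim (reachw v) l then
    \sum_(i < dim)
      if [&& firstw i, rank firstw dim i < nb_rep &
             bit p t (rank repw dim l * minn nb_rep dim + rank firstw dim i)]
      then valw i else 0
  else 0.

Definition sumw (p t v : nat) : nat :=
  \sum_(u < dim) if adjw v u then cand p t u else 0.

Definition same_mult (p t a : nat) : bool :=
  \sum_(x < dim) (cand p t x == a) == \sum_(x < dim) (valw x == a).

(** The labels themselves are verified, so soundness asks nothing of the guess, not even one value
    per class. *)
Definition check (p t : nat) : bool :=
  all (fun v => [&& sumw p t v == sumw p t 0, same_mult p t (valw v) &
                    same_mult p t (cand p t v)]) (iota 0 dim).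

(** [p] is both the number of guesses and the bit width at which they are read, which suffices since
    [t < p < 2 ^ p]. *)
Definition answer (p : nat) : bool := isolated || has (check p) (iota 0 p).

End Algorithm.

(** * Definability of the algorithm *)

Lemma def_dim : definable (fun w _ _ => dim w).
Proof. exact: def_in (def_num 0). Qed.

Lemma def_adjw F G : definable F -> definable G ->
  definable (fun w p env => adjw w (F w p env) (G w p env)).
Proof.
move=> dF dG; apply: def_not; apply: def_eq (def_num 0).
apply: def_in; apply: def_add (def_num 1) (def_add _ dG).
exact: (def_mul_bound false dF).
Qed.

Lemma def_valw F : definable F -> definable (fun w p env => valw w (F w p env)).
Proof.
move=> dF; apply: def_in; apply: def_add (def_num 1) (def_add _ dF).
exact: (def_mul_bound false def_dim).
Qed.

Lemma def_relw F G : definable F -> definable G ->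
  definable (fun w p env => relw w (F w p env) (G w p env)).
Proof.
move=> dF dG; apply: (def_has false); apply: (def_has false); apply: (def_all false).
have d0 := def_var 0; have d1 := def_var 1; have d2 := def_var 2.
have dF3 := def_ren (fun i => i.+3) dF; have dG3 := def_ren (fun i => i.+3) dG.
apply: def_eq; apply: def_add; do ?[exact: def_adjw | exact: def_eq].
Qed.

Lemma def_bitset b (P : seq nat -> nat -> nat -> (nat -> nat) -> bool) :
  definable (fun w p env => P w p (env 0) (fun i => env i.+1)) ->
  definable (fun w p env => bitset (bound b w p) (fun x => P w p x env)).
Proof.
move=> dP; apply: (@def_sum b (fun w p x env =>
  if P w p x env then 2 ^ minn x (bound b w p) else 0)).
apply: def_if; first exact: dP.
  exact: (def_pow2 b (def_var 0)).
exact: def_num.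
Qed.

Lemma def_reachw F : definable F ->
  definable (fun w p env => reachw w (F w p env)).
Proof.
move=> dF; apply: (def_iter false); first exact: (def_pow2 false dF).
apply: (def_bitset false); apply: (def_has false); apply: def_and.
  exact: (def_bit false (def_var 3) (def_var 0)).
exact: def_relw (def_var 0) (def_var 1).
Qed.

Lemma def_repw F : definable F -> definable (fun w p env => repw w (F w p env)).
Proof.
move=> dF; have dF1 := def_ren S dF.
apply: def_not; apply: (def_has false); apply: def_and.
  exact: def_ltn (def_var 0) dF1.
exact: (def_bit false (def_reachw dF1) (def_var 0)).
Qed.

Lemma def_firstw F : definable F ->
  definable (fun w p env => firstw w (F w p env)).
Proof.
move=> dF; have dF1 := def_ren S dF.
apply: def_not; apply: (def_has false); apply: def_and.
  exact: def_ltn (def_var 0) dF1.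
exact: def_eq (def_valw (def_var 0)) (def_valw dF1).
Qed.

Lemma def_rank (P : seq nat -> pred nat) F :
  definable (fun w _ env => P w (env 0)) -> definable F ->
  definable (fun w p env => rank (P w) (dim w) (F w p env)).
Proof.
move=> dP dF.
apply: (@def_sum false (fun w p j env => (j < F w p env) && P w j)).
apply: def_and.
  exact: def_ltn (def_var 0) (def_ren S dF).
exact: dP.
Qed.

Lemma def_nb_rep : definable (fun w _ _ => nb_rep w).
Proof. 
by apply: (@def_sum false (fun w _ l _ => repw w l)); apply: def_repw (def_var 0).
Qed.

Lemma def_isolated : definable (fun w _ _ => isolated w).
Proof.
apply: (def_all false); apply: def_not.
exact: def_adjw (def_num 0) (def_var 0).
Qed.

Lemma def_nb_guess : definable (fun w _ _ => nb_guess w).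
Proof.
apply: def_if; [exact: def_isolated|exact: def_num|].
exact: (def_pow2_sq false def_nb_rep).
Qed.

Lemma def_cand F G : definable F -> definable G ->
  definable (fun w p env => cand w p (F w p env) (G w p env)).
Proof.
move=> dF dG; have v0 := def_var 0; have v1 := def_var 1.
have dF2 := def_ren (fun i => i.+2) dF; have dG1 := def_ren S dG.
apply: (@def_sum false (fun w p l env =>
  if repw w l && bit (dim w) (reachw w (G w p env)) l then
    \sum_(i < dim w)
      if [&& firstw w i, rank (firstw w) (dim w) i < nb_rep w &
             bit p (F w p env) (rank (repw w) (dim w) l *
               minn (nb_rep w) (dim w) + rank (firstw w) (dim w) i)]
      then valw w i else 0
  else 0)).
apply: def_if; last exact: def_num.
  apply: def_and; first exact: def_repw.
  exact: (def_bit false (def_reachw dG1) v0).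
have rk1 := def_rank (P := firstw) (def_firstw v0) v0.
have rk2 := def_rank (P := repw) (def_repw v0) v1.
apply: (@def_sum false (fun w p i env =>
  if [&& firstw w i, rank (firstw w) (dim w) i < nb_rep w &
         bit p (F w p (fun j => env j.+1)) (rank (repw w) (dim w) (env 0) *
           minn (nb_rep w) (dim w) + rank (firstw w) (dim w) i)]
  then valw w i else 0)).
apply: def_if; [|exact: def_valw|exact: def_num].
apply: def_and; first exact: def_firstw.
apply: def_and; first exact: (def_ltn rk1 def_nb_rep).
apply: (def_bit true); [exact: dF2|apply: def_add; last exact: rk1].
exact: (def_mul false rk2 def_nb_rep).
Qed.

Lemma def_sumw F G : definable F -> definable G ->
  definable (fun w p env => sumw w p (F w p env) (G w p env)).
Proof.
move=> dF dG; have v0 := def_var 0.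
have dF1 := def_ren S dF; have dG1 := def_ren S dG.
apply: (@def_sum false (fun w p u env =>
  if adjw w (G w p env) u then cand w p (F w p env) u else 0)).
exact: def_if (def_adjw dG1 v0) (def_cand dF1 v0) (def_num 0).
Qed.

Lemma def_same_mult F G : definable F -> definable G ->
  definable (fun w p env => same_mult w p (F w p env) (G w p env)).
Proof.
move=> dF dG; have v0 := def_var 0.
have dF1 := def_ren S dF; have dG1 := def_ren S dG.
apply: def_eq.
  apply: (@def_sum false (fun w p x env =>
    cand w p (F w p env) x == G w p env)).
  exact: def_eq (def_cand dF1 v0) dG1.
apply: (@def_sum false (fun w p x env => valw w x == G w p env)).
exact: def_eq (def_valw v0) dG1.
Qed.

Lemma def_check F : definable F ->
  definable (fun w p env => check w p (F w p env)).
Proof.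
move=> dF; have v0 := def_var 0; have dF1 := def_ren S dF.
apply: (def_all false); apply: def_and; last apply: def_and.
- exact: def_eq (def_sumw dF1 v0) (def_sumw dF1 (def_num 0)).
- exact: def_same_mult dF1 (def_valw v0).
- exact: def_same_mult dF1 (def_cand dF1 v0).
Qed.

Lemma def_answer : definable (fun w p _ => answer w p).
Proof.
apply: def_or; [exact: def_isolated|apply: (def_has true)].
exact: def_check (def_var 0).
Qed.

(** * Correctness *)

Lemma nth_allpairs_row (T1 T2 R : Type) (f : T1 -> T2 -> R) x1 x2 x s t i j :
  i < size s -> j < size t ->
  nth x [seq f a b | a <- s, b <- t] (i * size t + j) = f (nth x1 s i) (nth x2 t j).
Proof.
elim: s i => [//|a s IHs] [|i] lt_i lt_j /=; rewrite nth_cat size_map.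
  by rewrite lt_j (nth_map x2).
by rewrite mulSn -addnA ltnNge leq_addr /= addKn IHs.
Qed.

Lemma has_ord m (P : pred nat) : has P (iota 0 m) = [exists i : 'I_m, P i].
Proof.
apply/hasP/existsP => [[i]|[i Pi]]; last by exists (i : nat); rewrite ?mem_iota /=.
by rewrite mem_iota => im Pi; exists (Ordinal im).
Qed.

Lemma all_ord m (P : pred nat) : all P (iota 0 m) = [forall i : 'I_m, P i].
Proof.
apply/allP/forallP => [allP i|allP i]; first by rewrite allP // mem_iota /=.
by rewrite mem_iota => im; apply: allP (Ordinal im).
Qed.

Lemma ltn_rank (P : pred nat) m i j : P i -> i < j -> j <= m ->
  rank P m i < rank P m j.
Proof.
move=> Pi ij jm; have im := leq_trans ij jm.
rewrite /rank (bigD1 (Ordinal im)) //= ltnn add0n.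
rewrite [ltnRHS](bigD1 (Ordinal im)) //= ij Pi ltnS.
apply: leq_sum => k _; case: (ltnP k i) => //= ki.
by rewrite (ltn_trans ki ij).
Qed.

Lemma rank_inj (P : pred nat) m i j : P i -> P j -> i < m -> j < m ->
  rank P m i = rank P m j -> i = j.
Proof.
move=> Pi Pj im jm eq_rank; case: (ltngtP i j) => // lt_ij.
  by have := ltn_rank Pi lt_ij (ltnW jm); rewrite eq_rank ltnn.
by have := ltn_rank Pj lt_ij (ltnW im); rewrite eq_rank ltnn.
Qed.

Lemma rank_lt (P : pred nat) m i : P i -> i < m ->
  rank P m i < \sum_(j < m) P j.
Proof.
move=> Pi im; apply: leq_trans (ltn_rank Pi im (leqnn m)) _.
by apply: leq_sum => j _; rewrite ltn_ord.
Qed.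

(** Sums of this kind serve the algorithm as a selection operator. *)
Lemma sum_pred1 (T : finType) (x : T) (P : pred T) (F : T -> nat) :
  P x -> (forall y, P y -> y = x) -> \sum_y (if P y then F y else 0) = F x.
Proof.
move=> Px uniq_x; rewrite (bigD1 x) //= Px big1 ?addn0 // => y yx.
by case: ifP => // /uniq_x eq_y; rewrite eq_y eqxx in yx.
Qed.

(** * Computed data, classes and labellings on an encoded graph *)

Section Encoding.
Variables (n : nat) (G : sgraph 'I_n) (S : seq nat).
Let w := encode G S.

Lemma dimE : dim w = n. Proof. by []. Qed.

Lemma size_adj : size [seq nat_of_bool (G i j) | i <- enum 'I_n, j <- enum 'I_n] = n * n.
Proof. by rewrite size_allpairs size_enum_ord. Qed.

Lemma adjwE (i j : 'I_n) : adjw w i j = G i j.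
Proof.
rewrite /adjw /= dimE nth_cat size_adj.
have -> : i * n + j < n * n by have := ltn_ord i; have := ltn_ord j; nia.
rewrite -[n in i * n]size_enum_ord.
by rewrite (nth_allpairs_row _ i i) ?size_enum_ord // !nth_ord_enum; case: (G i j).
Qed.

Lemma valwE i : valw w i = nth 0 S i.
Proof. by rewrite /valw /= dimE add0n nth_cat size_adj ltnNge leq_addr /= addKn. Qed.

Definition linked (u v : 'I_n) : bool :=
  [exists a, exists b, [forall x, G a x + (x == v) == G b x + (x == u)]].

Lemma relwE (u v : 'I_n) : relw w u v = linked u v.
Proof.
rewrite /relw has_ord; apply: eq_existsb => a; rewrite has_ord.
apply: eq_existsb => b; rewrite all_ord; apply: eq_forallb => x.
by rewrite !adjwE.
Qed.

Lemma linked_sym : symmetric linked.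
Proof.
move=> u v; apply/existsP/existsP => -[a /existsP[b /forallP eq_ab]];
  by exists b; apply/existsP; exists a; apply/forallP => x; rewrite eq_sym.
Qed.

Lemma linked_refl : reflexive linked.
Proof.
by move=> u; apply/existsP; exists u; apply/existsP; exists u; apply/forallP => x.
Qed.

Lemma linked_connect_sym : connect_sym linked.
Proof. exact: (sym_connect_sym linked_sym). Qed.

Definition reach (k : nat) (v u : 'I_n) : bool :=
  iter k (fun R x => [exists y, R y && linked y x]) (pred1 v) u.

(** A duplicate-free path has fewer than [n] edges, and reflexivity of [linked] lets the remaining
    rounds be spent in place. *)
Lemma reach_connect v u : reach n v u = connect linked v u.
Proof.
have reachS k x y : reach k v x -> linked x y -> reach k.+1 v y.
  by move=> vx xy; apply/existsP; exists x; apply/andP.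
apply/idP/idP.
  move: {1}n => k; elim: k u => [|k IHk] u; first by move/eqP->.
  by case/existsP => x /andP[/IHk vx xu]; apply: connect_trans (connect1 xu).
case/connectP => p0 /shortenP[p path_p uniq_p _] ->.
have reach_le k k' x : k <= k' -> reach k v x -> reach k' v x.
  elim: k' => [|k' IHk]; first by rewrite leqn0 => /eqP->.
  rewrite leq_eqVlt => /predU1P[-> //|lt_k /(IHk lt_k)/reachS]; apply.
  exact: linked_refl.
apply: (@reach_le (size p)).
  by rewrite ltnW // -[X in _ < X]card_ord -/(size (v :: p)) -(card_uniqP uniq_p) max_card.
have walk q x k : reach k v x -> path linked x q -> reach (k + size q) v (last x q).
  elim: q x k => [|y q IHq] x k vx /=; first by rewrite addn0.
  by case/andP=> xy; rewrite -addSnnS; apply: IHq; apply: reachS xy.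
by apply: (walk p v 0) path_p; apply: eqxx.
Qed.

Lemma reachwE (v u : 'I_n) : bit n (reachw w v) u = connect linked v u.
Proof.
rewrite -reach_connect.
(* Each stage is tracked with a predicate that it encodes, because [bit_bitset] reads back only
   codes of the form [bitset n f]. *)
suff /(_ n)[f [zE fE]] k : exists f : nat -> bool,
    iteri k (fun _ z =>
      bitset n (fun x => has (fun u => bit n z u && relw w u x) (iota 0 n)))
      (2 ^ minn v n) = bitset n f /\ forall x : 'I_n, f x = reach k v x.
  by rewrite -fE -(@bit_bitset n f) // -zE.
elim: k => [|k [f [zE fE]]].
  exists (fun x => x == v :> nat); split=> //.
  by rewrite /bitset (@sum_pred1 _ v (fun x : 'I_n => x == v :> nat)) // => y /eqP/val_inj.
exists (fun x => has (fun u => bit n (bitset n f) u && relw w u x) (iota 0 n)).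
split=> [|x]; first by rewrite /= zE.
by rewrite has_ord; apply: eq_existsb => y; rewrite bit_bitset // fE relwE.
Qed.

Definition is_rep (l : 'I_n) : bool := [forall u : 'I_n, (u < l) ==> ~~ connect linked l u].

Lemma repwE (l : 'I_n) : repw w l = is_rep l.
Proof.
rewrite /repw has_ord negb_exists; apply: eq_forallb => u.
by rewrite reachwE negb_and -implybE; case: (u < l).
Qed.

Lemma rep_exists v : exists2 l, is_rep l & connect linked v l.
Proof.
case: (@arg_minnP _ v (connect linked v) (fun u : 'I_n => u : nat)) => // l vl min_l.
exists l => //; apply/forallP => u; apply/implyP => ul; apply/negP => lu.
by have := min_l u (connect_trans vl lu); rewrite leqNgt ul.
Qed.

Lemma rep_unique l l' : is_rep l -> is_rep l' -> connect linked l l' -> l = l'.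
Proof.
move=> /forallP/(_ l') min_l /forallP/(_ l) min_l' ll'; apply: val_inj => /=.
move: min_l min_l'; rewrite ll' linked_connect_sym ll'.
by case: ltngtP.
Qed.

Lemma nb_repE : nb_rep w = #|is_rep|.
Proof.
rewrite -sum1_card [RHS]big_mkcond; apply: eq_bigr => l _.
by rewrite repwE unfold_in -/(is_rep l); case: (is_rep l).
Qed.

(** Sending each representative to a member of its class in [Y] is injective. Bounding the classes
    thus amounts to finding a small set that meets all of them. *)
Lemma nb_rep_le (Y : {set 'I_n}) :
  (forall v, exists2 y, y \in Y & connect linked v y) -> nb_rep w <= #|Y|.
Proof.
move=> meetY; rewrite nb_repE.
pose h v := odflt v [pick y in Y | connect linked v y].
have hP v : h v \in Y /\ connect linked v (h v).
  rewrite /h; case: pickP => [y /andP[] //|no_y].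
  by have [y Yy vy] := meetY v; have := no_y y; rewrite Yy vy.
rewrite -(@card_in_imset _ _ h is_rep).
  by apply/subset_leq_card/subsetP => _ /imsetP[v _ ->]; case: (hP v).
move=> l l' rep_l rep_l' eq_h; apply: rep_unique => //.
apply: connect_trans (hP l).2 _; rewrite eq_h linked_connect_sym.
exact: (hP l').2.
Qed.

Lemma isolatedP r : (forall v, #|nbhd G v| = r) ->
  reflect (forall v, nbhd G v = set0) (isolated w).
Proof.
move=> deg; rewrite /isolated all_ord.
apply: (iffP forallP) => [iso v | iso x].
  have n0 : 0 < n by apply: leq_ltn_trans (ltn_ord v).
  apply/eqP; rewrite -cards_eq0 deg -(deg (Ordinal n0)) cards_eq0.
  by apply/eqP/setP => x; rewrite !inE -adjwE; apply/negbTE/iso.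
have n0 : 0 < n by apply: leq_ltn_trans (ltn_ord x).
rewrite -[0]/(val (Ordinal n0)) adjwE.
by have /setP/(_ x) := iso (Ordinal n0); rewrite !inE => ->.
Qed.

(** Fairness in terms of values alone, forgetting which occurrence in [S] a vertex receives. *)
Definition labelling (f : 'I_n -> nat) : Prop :=
  perm_eq [seq f x | x <- enum 'I_n] S /\
  exists k, forall v, \sum_(u in nbhd G v) f u = k.

Hypothesis size_S : size S = n.

Lemma fairP : fair G S <-> exists f, labelling f.
Proof.
split=> [[pi [bij_pi [k sumE]]]|[f [perm_f [k sumE]]]].
  exists (fun v => nth 0 S (pi v)); split; last by exists k.
  have: perm_eq [seq pi x | x <- enum 'I_n] (enum 'I_(size S)).
    apply: uniq_perm; rewrite ?enum_uniq ?(map_inj_uniq (bij_inj bij_pi)) ?enum_uniq //.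
    move=> y; rewrite mem_enum inE; case: bij_pi => qi _ piK.
    by apply/mapP; exists (qi y); rewrite ?piK ?mem_enum.
  move=> /(perm_map (fun y : 'I_(size S) => nth 0 S y)).
  rewrite -map_comp (_ : map _ (enum 'I_(size S)) = S) //.
  by rewrite (map_comp (nth 0 S) val) val_enum_ord map_nth_iota0 // take_size.
have [Is perm_Is fE] := perm_iotaP 0 perm_f.
have size_Is : size Is = n by rewrite (perm_size perm_Is) size_iota.
have lt_Is (v : 'I_n) : nth 0 Is v < size S.
  have := mem_nth 0 (_ : v < size Is); rewrite size_Is => /(_ (ltn_ord v)).
  by rewrite (perm_mem perm_Is) mem_iota.
have uniq_Is : uniq Is by rewrite (perm_uniq perm_Is) iota_uniq.
exists (fun v => Ordinal (lt_Is v)); split; last first.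
  exists k => v; rewrite -(sumE v); apply: eq_bigr => u _ /=.
  have := congr1 (fun s => nth 0 s u) fE.
  by rewrite (nth_map u) ?size_enum_ord // nth_ord_enum => ->; rewrite (nth_map 0) ?size_Is.
have inj_pi : injective (fun v => Ordinal (lt_Is v)).
  move=> u v [/eqP]; rewrite nth_uniq ?size_Is // => /eqP; exact: val_inj.
by apply: inj_card_bij inj_pi _; rewrite !card_ord size_S.
Qed.

Section Candidate.
Variables (p t : nat).
Let f (v : 'I_n) := cand w p t v.

Lemma sumwE (v : 'I_n) : sumw w p t v = \sum_(u in nbhd G v) f u.
Proof.
rewrite [RHS]big_mkcond; apply: eq_bigr => u _.
by rewrite inE adjwE.
Qed.

Lemma count_sum (s : seq nat) a : count_mem a s = \sum_(i < size s) (nth 0 s i == a).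
Proof. by rewrite -sum1_count big_mkcond (big_nth 0) big_mkord; apply: eq_bigr. Qed.

Lemma same_multE a :
  same_mult w p t a = (count_mem a [seq f x | x <- enum 'I_n] == count_mem a S).
Proof.
rewrite /same_mult !count_sum size_map size_enum_ord size_S.
congr (_ == _); apply: eq_bigr => x _; last by rewrite valwE.
by rewrite (nth_map x) ?size_enum_ord // nth_ord_enum.
Qed.

(** [perm_eq] compares multiplicities at the members of the two lists, and these are the values that
    [check] tests. *)
Lemma checkP : reflect (labelling f) (check w p t).
Proof.
rewrite /check all_ord; apply: (iffP forallP) => [chk|[perm_f [k sumE]] v].
  split.
    apply/allP => a; rewrite mem_cat => /orP[/mapP[v _ ->]|/(nthP 0)[i iS <-]].
      by have /and3P[_ _] := chk v; rewrite same_multE.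
    have i_n : i < n by rewrite -size_S.
    by have /and3P[_ + _] := chk (Ordinal i_n); rewrite same_multE valwE.
  exists (sumw w p t 0) => v.
  by have /and3P[/eqP + _ _] := chk v; rewrite sumwE.
have n0 : 0 < n by apply: leq_ltn_trans (ltn_ord v).
rewrite -[0]/(val (Ordinal n0)) !sumwE !sumE eqxx !same_multE.
by move/permP: perm_f => countE; rewrite !countE !eqxx.
Qed.

End Candidate.

Lemma firstwE (i : 'I_n) : firstw w i = (index (nth 0 S i) S == i).
Proof.
have iS : i < size S by rewrite size_S.
rewrite /firstw has_ord negb_exists; apply/forallP/eqP => [min_i|idx_i j].
  apply/eqP; rewrite eqn_leq -ltnS leqNgt; apply/andP; split.
    by apply/negP => lt_i; have := before_find 0 lt_i; rewrite /= eqxx.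
  rewrite leqNgt; apply/negP => lt_i; have lt_n := ltn_trans lt_i (ltn_ord i).
  have := min_i (Ordinal lt_n).
  by rewrite !valwE /= lt_i nth_index ?eqxx // mem_nth.
rewrite !valwE; apply/negP => /andP[ji eq_ij].
by have := before_find 0 (_ : j < index (nth 0 S i) S); rewrite idx_i ji /= eq_ij => /(_ isT).
Qed.

(** As multisets, the neighbours of [a] plus [v] are the neighbours of [b] plus [u]. Summing [f]
    over both gives [k + f v = k + f u]. *)
Lemma linked_eq f u v : labelling f -> linked u v -> f u = f v.
Proof.
move=> [_ [k sumE]] /existsP[a /existsP[b /forallP eq_ab]].
have sum_plus y z : \sum_x f x * (G y x + (x == z)) = k + f z.
  rewrite -(sumE y); under eq_bigr do rewrite mulnDr.
  rewrite big_split /=; congr (_ + _).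
    by rewrite [RHS]big_mkcond; apply: eq_bigr => x _; rewrite inE; case: (G y x); lia.
  by rewrite (bigD1 z) //= eqxx muln1 big1 ?addn0 // => x /negbTE->; rewrite muln0.
apply/eqP; rewrite -(eqn_add2l k) -(sum_plus b) -(sum_plus a); apply/eqP.
by apply: eq_bigr => x _; rewrite (eqP (eq_ab x)).
Qed.

Lemma connect_eq f u v : labelling f -> connect linked u v -> f u = f v.
Proof.
move=> lab_f /connectP[q path_q ->]; elim: q u path_q => //= x q IHq u.
by case/andP=> /(linked_eq lab_f)-> /IHq.
Qed.

Lemma first_exists a : a \in S -> exists2 i : 'I_n, firstw w i & nth 0 S i = a.
Proof.
move=> aS; have := aS; rewrite -index_mem size_S => lt_i.
by exists (Ordinal lt_i); rewrite ?firstwE /= nth_index.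
Qed.

Lemma first_unique (i j : 'I_n) : firstw w i -> firstw w j ->
  nth 0 S i = nth 0 S j -> i = j.
Proof.
rewrite !firstwE => /eqP idx_i /eqP idx_j eq_ij; apply: val_inj.
by rewrite /= -idx_i -idx_j eq_ij.
Qed.

Lemma labelling_mem f v : labelling f -> f v \in S.
Proof. by move=> [/perm_mem <- _]; apply: map_f; rewrite mem_enum. Qed.

(** Every value of [S] is the label of some vertex, hence of the representative of its class, and
    distinct values need distinct representatives. *)
Lemma nb_first_le f : labelling f -> \sum_(i < n) firstw w i <= nb_rep w.
Proof.
move=> lab_f; rewrite nb_repE.
pose h (i : 'I_n) := odflt i [pick l | is_rep l && (f l == nth 0 S i)].
have hP i : is_rep (h i) /\ f (h i) = nth 0 S i.
  rewrite /h; case: pickP => [l /andP[rep_l /eqP fl] //|no_l].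
  have : nth 0 S i \in S by rewrite mem_nth ?size_S.
  have [perm_f _] := lab_f.
  rewrite -(perm_mem perm_f) => /mapP[v _ Si]; have [l rep_l vl] := rep_exists v.
  by have := no_l l; rewrite rep_l Si (connect_eq lab_f vl) eqxx.
have -> : \sum_(i < n) firstw w i = #|[pred i : 'I_n | firstw w i]|.
  by rewrite -sum1_card [RHS]big_mkcond.
rewrite -(@card_in_imset _ _ h) => [|i j first_i first_j eq_h].
  by apply/subset_leq_card/subsetP => _ /imsetP[i _ ->]; case: (hP i).
by apply: first_unique => //; rewrite -(hP i).2 -(hP j).2 eq_h.
Qed.

Let c := nb_rep w.

Lemma nb_rep_le_n : c <= n.
Proof. by rewrite /c nb_repE -[X in _ <= X]card_ord max_card. Qed.

(** The right guess is the matrix whose row for the class of [l] has its only 1 in the column of the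
    value [f l]. *)
Lemma cand_complete f : labelling f ->
  exists2 t, t < 2 ^ (c * c) & forall v : 'I_n, cand w (2 ^ (c * c)) t v = f v.
Proof.
move=> lab_f.
pose code (l i : nat) := rank (repw w) n l * c + rank (firstw w) n i.
pose P e := [exists l : 'I_n, exists i : 'I_n,
  [&& is_rep l, firstw w i, e == code l i & nth 0 S i == f l]].
have rank_i (i : 'I_n) : firstw w i -> rank (firstw w) n i < c.
  by move=> fi; apply: leq_trans (rank_lt fi (ltn_ord i)) (nb_first_le lab_f).
have rank_l (l : 'I_n) : is_rep l -> rank (repw w) n l < c.
  by rewrite -repwE => rl; apply: rank_lt rl (ltn_ord l).
have code_lt (l i : 'I_n) : is_rep l -> firstw w i -> code l i < c * c.
  move=> /rank_l ltl /rank_i lti; rewrite /code.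
  by apply: leq_trans (_ : (rank (repw w) n l).+1 * c <= _);
    rewrite ?leq_mul2r ?ltl ?orbT // mulSn addnC ltn_add2r.
have code_inj (l l' i i' : 'I_n) : is_rep l -> is_rep l' -> firstw w i ->
    firstw w i' -> code l i = code l' i' -> l = l' /\ i = i'.
  move=> rl rl' fi fi' eq_code.
  have c0 : 0 < c by apply: leq_ltn_trans (rank_l _ rl).
  have eq_l : rank (repw w) n l = rank (repw w) n l'.
    have := congr1 (divn^~ c) eq_code.
    by rewrite /= /code !divnMDl // !divn_small ?addn0 ?rank_i.
  have eq_i : rank (firstw w) n i = rank (firstw w) n i'.
    by move: eq_code; rewrite /code eq_l => /addnI.
  split; apply: val_inj; last exact: rank_inj fi fi' _ _ eq_i.
  by move: rl rl'; rewrite -!repwE => rl rl'; apply: rank_inj rl rl' _ _ eq_l.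
exists (bitset (c * c) P); first exact: bitset_lt.
move=> v; set p := 2 ^ (c * c); set t := bitset _ _.
(* The guess is built with width [c * c] but read with width [p]; the position [e] and the number
   [t] fit both. *)
have bit_t e : e < c * c -> bit p t e = P e.
  move=> lt_e; have lt_t : t < p := bitset_lt _ _.
  rewrite bitE; first by rewrite -(@bitE (c * c)) // bit_bitset.
    exact: ltn_trans lt_e (ltn_expl _ (ltnSn 1)).
  exact: ltn_trans lt_t (ltn_expl _ (ltnSn 1)).
have [l rep_l vl] := rep_exists v.
have [i first_i Si] := first_exists (labelling_mem l lab_f).
rewrite /cand dimE -/c.
have -> : minn c n = c by apply/minn_idPl/nb_rep_le_n.
(* Only the representative of [v] contributes to the outer sum, and only the column of its label to
   the inner one. *)
rewrite (@sum_pred1 _ l (fun l : 'I_n => repw w l && bit n (reachw w v) l)).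
- rewrite (@sum_pred1 _ i (fun i : 'I_n => [&& firstw w i,
    rank (firstw w) n i < c & bit p t (code l i)])).
  + by rewrite valwE Si (connect_eq lab_f vl).
  + rewrite first_i rank_i // bit_t ?code_lt //.
    by apply/existsP; exists l; apply/existsP; exists i; rewrite rep_l first_i Si !eqxx.
  + move=> j /and3P[first_j _]; rewrite bit_t ?code_lt //.
    case/existsP => l' /existsP[i' /and4P[rep_l' first_i' /eqP eq_code /eqP Si']].
    have [ll' ji'] := code_inj _ _ _ _ rep_l rep_l' first_j first_i' eq_code.
    by apply: first_unique => //; rewrite Si ji' Si' ll'.
- by rewrite repwE rep_l reachwE.
- move=> l'; rewrite repwE reachwE => /andP[rep_l' vl']; apply: rep_unique => //.
  by apply: connect_trans vl; rewrite linked_connect_sym.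
Qed.

Lemma labelling_ext f g : f =1 g -> labelling f -> labelling g.
Proof.
move=> fg [perm_f [k sumE]]; split; first by rewrite -(eq_map fg).
by exists k => v; rewrite -(sumE v); apply: eq_bigr => u _; rewrite fg.
Qed.

Lemma answerP r : (forall v, #|nbhd G v| = r) ->
  (answer w (nb_guess w) : nat) != 0 <-> fair G S.
Proof.
move=> deg; rewrite eqb0 negbK /answer /nb_guess.
have -> : minn (nb_rep w) (dim w) = c by apply/minn_idPl/nb_rep_le_n.
case: (isolatedP deg) => [iso|not_iso] /=.
  (* Without edges all neighbourhood sums are empty, so any bijection works with [k = 0]. *)
  split=> // _; exists (cast_ord (esym size_S)); split.
    exact: (Bijective (cast_ordK _) (cast_ordKV _)).
  by exists 0 => v; rewrite iso big_set0.
split=> [/hasP[t _ /checkP lab]|/fairP[f lab_f]].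
  by apply/fairP; exists (fun v => cand w (2 ^ (c * c)) t v).
have [t lt_t candE] := cand_complete lab_f.
apply/hasP; exists t; first by rewrite mem_iota.
apply/checkP; apply: labelling_ext lab_f => v; exact/esym/candE.
Qed.

End Encoding.

(** * Number of classes and feedback vertex sets *)

Section Forests.
Variables (V : finType) (G : sgraph V).

Lemma acyclic_onS (A B : {set V}) : B \subset A -> acyclic_on G A -> acyclic_on G B.
Proof.
move=> /subsetP BA /acyclic_onP acA; apply/acyclic_onP => s s2 sB.
by apply: acA => // x /sB/BA.
Qed.

(* Prolonging a path at its head never closes a cycle, so it would never stop. *)
Lemma acyclic_low_degree (A : {set V}) (v0 : V) : acyclic_on G A -> v0 \in A ->
  exists2 v, v \in A & #|nbhd G v :&: A| <= 1.
Proof.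
move=> /acyclic_onP acA v0A.
have [|no_low] := boolP [exists v in A, #|nbhd G v :&: A| <= 1].
  by case/exists_inP => v vA le1; exists v.
have deg2 v : v \in A -> 1 < #|nbhd G v :&: A|.
  move=> vA; rewrite ltnNge; apply: contra no_low => le1.
  by apply/exists_inP; exists v.
have long k : exists x p, [/\ path G x p, uniq (x :: p), {subset x :: p <= A}
    & size p = k].
  elim: k => [|k [x [p [path_p uniq_p pA size_p]]]].
    by exists v0, [::]; split=> // x; rewrite inE => /eqP->.
  have xA : x \in A by apply: pA; rewrite mem_head.
  (* [y] follows [x] on the path, or is [x] itself if the path is a single vertex; two neighbours
     inside [A] leave one, [z], different from [y]. *)
  pose y := head x p.
  have [z] : exists z, z \in (nbhd G x :&: A) :\ y.
    by apply/card_gt0P; have := cardsD1 y (nbhd G x :&: A); have := deg2 x xA; lia.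
  rewrite !inE => /and3P[zy xz zA].
  have [zp|zp] := boolP (z \in x :: p); last first.
    exists z, (x :: p); split=> //=; last by rewrite size_p.
    - by rewrite (adj_sym G z x) xz.
    - by rewrite zp.
    - by move=> u; rewrite inE => /predU1P[->|/pA].
  have zx : z != x by apply: contraTneq xz => ->; rewrite adj_irrefl.
  move: zp path_p uniq_p pA zy; rewrite inE (negbTE zx) /= /y.
  case: p {size_p y} => // y q; rewrite inE /= => /predU1P[->|]; first by rewrite eqxx.
  case/splitPr => q1 q2 path_p uniq_p pA _.
  (* A visited [z] lies beyond [y], so the stretch from [x] to [z] closes into a cycle of at least
     three vertices. *)
  case: (acA (x :: y :: rcons q1 z)) => [|u us|].
  - by rewrite /= size_rcons.
  - apply: pA; move: us; rewrite !inE mem_rcons mem_cat !inE.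
    by case/or4P=> ->; rewrite ?orbT.
  - have e : x :: y :: q1 ++ z :: q2 = (x :: y :: rcons q1 z) ++ q2.
      by rewrite /= cat_rcons.
    apply/andP; split.
      move: path_p; rewrite -cat_rcons /= => /andP[-> +]; rewrite cat_path.
      case/andP=> path_z _; rewrite rcons_path last_rcons path_z.
      by rewrite (adj_sym G z x) xz.
    have : uniq ((x :: y :: rcons q1 z) ++ q2) by rewrite -e.
    by rewrite cat_uniq => /andP[].
have [x [p [_ uniq_p _ size_p]]] := long #|V|.
by have := max_card (mem (x :: p)); rewrite (card_uniqP uniq_p) /= size_p ltnn.
Qed.

(** Removing a vertex with at most one neighbour in [A] lowers the sum by at most 2: its own degree,
    and one at that neighbour. *)
Lemma acyclic_degree_sum (A : {set V}) : acyclic_on G A ->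
  \sum_(v in A) #|nbhd G v :&: A| <= 2 * #|A|.
Proof.
move: {2}#|A| (leqnn #|A|) => m; elim: m A => [|m IHm] A.
  by rewrite leqn0 cards_eq0 => /eqP-> _; rewrite big_set0.
move=> le_m acA; have [->|[v0 v0A]] := set_0Vmem A; first by rewrite big_set0.
have [v vA low_v] := acyclic_low_degree acA v0A.
have le_m' : #|A :\ v| <= m by have := cardsD1 v A; rewrite vA; lia.
have := IHm _ le_m' (acyclic_onS (subD1set A v) acA).
rewrite (cardsD1 v A) vA (@big_setD1 _ _ _ _ v A) //=.
have -> : \sum_(u in A :\ v) #|nbhd G u :&: A| =
    \sum_(u in A :\ v) (G u v + #|nbhd G u :&: (A :\ v)|).
  apply: eq_bigr => u _; rewrite (cardsD1 v) setIDA !inE vA andbT.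
  by [].
rewrite big_split /=.
have -> : \sum_(u in A :\ v) G u v = #|nbhd G v :&: A|.
  rewrite -sum1_card [LHS]big_mkcond [RHS]big_mkcond; apply: eq_bigr => u _.
  rewrite !inE (adj_sym G u v); case: (altP (u =P v)) => [->|_] /=.
    by rewrite adj_irrefl.
  by case: (u \in A); case: (G v u).
lia.
Qed.

Variable r : nat.
Hypothesis deg : forall v, #|nbhd G v| = r.

(** With [F] the complement of [X], counting edge ends at [F] gives [r * |F| <= 2 * |F| + r * |X|].
    Since [r <= 3 * (r - 2)], it follows that [|F| <= 3 * |X|]. *)
Lemma regular_fvs_bound (X : {set V}) : 2 < r -> feedback_vertex_set G X ->
  #|V| <= 4 * #|X|.
Proof.
move=> r3 acF; have := acyclic_degree_sum acF.
set F := ~: X => sumF.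
have split_deg v : r = #|nbhd G v :&: F| + #|nbhd G v :&: X|.
  by rewrite -(deg v) -(cardsID X (nbhd G v)) setDE addnC.
have cardI (Y : {set V}) v : #|nbhd G v :&: Y| = \sum_(y in Y) G v y.
  rewrite -sum1_card [LHS]big_mkcond [RHS]big_mkcond; apply: eq_bigr => u _.
  by rewrite !inE; case: (G v u); case: (u \in Y).
have cross : \sum_(v in F) #|nbhd G v :&: X| <= r * #|X|.
  under eq_bigr do rewrite cardI.
  rewrite exchange_big /= mulnC -sum_nat_const; apply: leq_sum => x _.
  under eq_bigr do rewrite adj_sym.
  by rewrite -cardI -(deg x) subset_leq_card ?subsetIl.
have total : r * #|F| = \sum_(v in F) #|nbhd G v :&: F| + \sum_(v in F) #|nbhd G v :&: X|.
  by rewrite -big_split mulnC -sum_nat_const; apply: eq_bigr.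
have := cardsC X; rewrite -/F.
case: (r) r3 total cross => [|[|[|k]]] // _; nia.
Qed.

(** Otherwise the vertices that cannot reach [X] form a nonempty acyclic set closed under
    neighbours, so one of them has degree at most 1 in [G]. *)
Lemma meets_fvs (X : {set V}) v : 1 < r -> feedback_vertex_set G X ->
  exists2 x, x \in X & connect G v x.
Proof.
move=> r2 acF.
have [/exists_inP[x xX vx]|none] := boolP [exists x in X, connect G v x].
  by exists x.
pose A := [set u | ~~ [exists x in X, connect G u x]].
have AF : A \subset ~: X.
  apply/subsetP => u; rewrite !inE; apply: contra => uX.
  by apply/exists_inP; exists u.
have vA : v \in A by rewrite inE.
have [u uA] := acyclic_low_degree (acyclic_onS AF acF) vA.
suff /setIidPl-> : nbhd G u \subset A by rewrite deg leqNgt r2.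
apply/subsetP => y; rewrite !inE in uA *; move=> uy; apply: contra uA.
case/exists_inP => x xX yx; apply/exists_inP; exists x => //.
exact: connect_trans (connect1 uy) yx.
Qed.

Definition ball (X : {set V}) : {set V} := X :|: \bigcup_(x in X) nbhd G x.

Lemma card_ball X : #|ball X| <= (1 + r) * #|X|.
Proof.
apply: leq_trans (leq_card_setU _ _) _; rewrite mulSn leq_add2l.
rewrite mulnC -sum_nat_const.
apply: (@leq_trans (\sum_(x in X) #|nbhd G x|)); last first.
  by apply: leq_sum => x _; rewrite deg.
elim/big_rec2: _ => [|x m B _ le_B]; first by rewrite cards0.
by apply: leq_trans (leq_card_setU _ _) _; rewrite leq_add2l.
Qed.

Lemma in_ball (X : {set V}) x y : y \in X -> G x y -> x \in ball X.
Proof.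
move=> yX xy; rewrite inE; apply/orP; right; apply/bigcupP; exists y => //.
by rewrite inE adj_sym.
Qed.

Lemma ballS (X : {set V}) : {subset X <= ball X}.
Proof. by move=> x xX; rewrite inE xX. Qed.

End Forests.

(** * Bounding the number of classes by the feedback vertex number *)

Section Classes.
Variables (n : nat) (G : sgraph 'I_n).

Lemma nbhd2 (v x y : 'I_n) : #|nbhd G v| = 2 -> G v x -> G v y -> x != y ->
  forall z, G v z = (z == x) || (z == y).
Proof.
move=> deg_v vx vy xy z; have: [set x; y] == nbhd G v.
  rewrite eqEcard deg_v cards2 xy andbT.
  by apply/subsetP => u; rewrite !inE => /orP[]/eqP->.
by move/eqP/setP/(_ z); rewrite !inE.
Qed.

(* On a cycle, vertices four apart are linked. *)
Lemma linked_ball3 (X : {set 'I_n}) (p : seq 'I_n) (v : 'I_n) : (forall v, #|nbhd G v| = 2) ->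
  path G v p -> last v p \in X ->
  exists2 y, y \in ball G (ball G (ball G X)) & connect (linked G) v y.
Proof.
move=> deg; move: {2}(size p) (leqnn (size p)) => m.
elim: m p v => [|m IHm] p v; first by case: p => // _ _ vX; exists v; rewrite ?ballS.
have sub := @ballS _ G; have into := @in_ball _ G.
case: p => [|v1 [|v2 [|v3 [|v4 q]]]] /= le_m.
- by move=> _ vX; exists v; rewrite ?sub.
- by case/andP=> e1 _ v1X; exists v => //; apply/sub/sub/(into _ _ v1).
- case/and3P=> e1 e2 _ v2X; exists v => //; apply/sub/(into _ _ v1) => //.
  exact: (into _ _ v2).
- case/and4P=> e1 e2 e3 _ v3X; exists v => //; apply/(into _ _ v1) => //.
  by apply/(into _ _ v2) => //; apply/(into _ _ v3).
case/and5P=> e1 e2 e3 e4 path_q lastX.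
(* A walk that turns back at [v1] or at [v3] is shortened by two edges. *)
have [v_v2|v_v2] := eqVneq v v2.
  by apply: (IHm [:: v3, v4 & q]) => //=; [lia | rewrite v_v2 e3 e4].
have [v2_v4|v2_v4] := eqVneq v2 v4.
  by apply: (IHm [:: v1, v2 & q]) => //=; [lia | rewrite e1 e2 v2_v4 | rewrite v2_v4].
have [|||y yB v4y] := IHm q v4 => //; first by lia.
exists y => //; apply: connect_trans (connect1 _) v4y.
(* [v1] has neighbours [v], [v2] and [v3] has neighbours [v2], [v4]; adding [v4] to the first pair
   and [v] to the second gives the same multiset. *)
apply/existsP; exists v1; apply/existsP; exists v3; apply/forallP => x.
have e1' : G v1 v by rewrite adj_sym.
have e3' : G v3 v2 by rewrite adj_sym.
rewrite (nbhd2 (deg v1) e1' e2 v_v2) (nbhd2 (deg v3) e3' e4 v2_v4).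
case: (eqVneq x v) => [->|_]; first by rewrite (negbTE v_v2); case: (v == v4).
case: (eqVneq x v2) => [->|_]; first by rewrite (negbTE v2_v4).
by case: (x == v4).
Qed.

(** For [r = 2] each of the three balls multiplies the size by at most [1 + r = 3], whence 27. The
    [+ 1] covers 1-regular graphs, which are forests with a single class. *)
Lemma nb_rep_fvs r S : (forall v, #|nbhd G v| = r) -> 0 < r ->
  nb_rep (encode G S) <= 27 * fvs G + 1.
Proof.
move=> deg r0; have [[X fX <-] _] := fvsP G.
have [r_le|r_gt] := leqP r 2; last first.
  apply: leq_trans (nb_rep_le_n G S) _.
  by have := regular_fvs_bound deg r_gt fX; rewrite card_ord; lia.
have [r2|r1] : r = 2 \/ r = 1 by lia.
  subst r; apply: leq_trans (nb_rep_le S (Y := ball G (ball G (ball G X))) _) _.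
    move=> v; have [x xX /connectP[p path_p eq_x]] := meets_fvs deg v (ltnSn 1) fX.
    by apply: (linked_ball3 (p := p)); rewrite -?eq_x.
  have b X' := card_ball deg X'.
  by have := b X; have := b (ball G X); have := b (ball G (ball G X)); lia.
subst r; have [n0|n0] := posnP n.
  by apply: leq_trans (nb_rep_le_n G S) _; lia.
apply: (@leq_trans #|[set Ordinal n0]|); last by rewrite cards1 addn1.
apply: nb_rep_le => // v; exists (Ordinal n0); first exact: set11.
apply: connect1.
(* In a perfect matching the partner of [u] has [u] as its only neighbour, so the two partners
   witness that [v] and vertex 0 are linked. *)
have nb u : exists a, forall x, G a x = (x == u).
  have /eqP/cards1P[a Na] := deg u; exists a => x.
  have /eqP/cards1P[b Nb] := deg a.
  have ua : G u a by have /setP/(_ a) := Na; rewrite !inE eqxx.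
  have : u \in nbhd G a by rewrite inE adj_sym.
  by rewrite Nb inE => /eqP->; have /setP/(_ x) := Nb; rewrite !inE.
have [[a Ea] [b Eb]] := (nb v, nb (Ordinal n0)).
apply/existsP; exists a; apply/existsP; exists b; apply/forallP => x.
by rewrite Ea Eb addnC.
Qed.

End Classes.

(** * Running time *)

(** Shaped to absorb constants: with [m = 27 * k + 2] and [a = K + d] it dominates
    [K * (2 ^ (m * m)) ^ d]. *)
Definition time_factor (a k : nat) : nat :=
  2 ^ ((a * (27 * k + 2)) * (a * (27 * k + 2))).

(** The first phase makes [a * (27 * n + 2)] the parameter, so the second has loops of that length
    for the squared exponent. *)
Lemma computable_time_factor a : computable (time_factor a).
Proof.
have [e1 e1E] : definable (fun w _ _ => (a * 27) * dim w + a * 2).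
  exact: def_add (def_mul_bound false (def_num _)) (def_num _).
have [e2 e2E] := def_pow2_sq true def_par.
have [K [d run]] := two_phase_ok e1 e2.
exists (two_phase e1 e2) => n; have [t run_n _] := run [:: n]; exists t.
move: run_n; rewrite e2E e1E /= minnn; congr (runs _ _ _ (2 ^ _)).
by rewrite /dim /=; congr (_ * _); lia.
Qed.

Lemma size_le_input_size w : size w <= input_size w.
Proof.
by rewrite /input_size -sum1_size; apply: leq_sum => x _.
Qed.

Theorem theorem7 :
  exists (p : prog) (g : nat -> nat) (c : nat),
    computable g /\
    forall (n : nat) (G : sgraph 'I_n) (S : seq nat),
      regular G -> size S = n -> (forall a : nat, a \in S -> 0 < a) ->
      exists t out : nat,
        [/\ runs p (encode G S) t out,
            t <= g (fvs G) * input_size (encode G S) ^ c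
          & (out != 0 <-> fair G S)].
Proof.
have [e1 e1E] := def_nb_guess; have [e2 e2E] := def_answer.
have [K [d run]] := two_phase_ok e1 e2.
exists (two_phase e1 e2), (time_factor (K + d)), d.
split=> [|n G S [r deg] size_S _]; first exact: computable_time_factor.
set w := encode G S; have [t run_w le_t] := run w.
rewrite e2E e1E in run_w le_t.
exists t, (answer w (nb_guess w)); split=> //; last exact: answerP deg.
set m := 27 * fvs G + 2; set s := input_size w.
(* The encoding has [1 + n * n + n] entries, each of bit length at least 1. *)
have n_lt_s : n < s.
  apply: leq_trans (size_le_input_size w).
  by rewrite /w /= size_cat size_adj size_S; lia.
(* At most [m - 1] classes give an exponent at most [(m - 1) ^ 2], which is below [m * m - 1]. The
   factor 2 saved here pays for [n + s + 1 <= 2 * s] in [base_le]. *)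
have guess_le : nb_guess w < 2 ^ (m * m).-1.
  rewrite /nb_guess; case: (isolatedP S deg) => [_|not_iso]; first by rewrite expn_gt0.
  have r0 : 0 < r.
    rewrite lt0n; apply/eqP => r0; apply: not_iso => v.
    by apply/eqP; rewrite -cards_eq0 deg r0.
  have := nb_rep_fvs S deg r0; rewrite -/w ltn_exp2l // => le_rep.
  have : minn (nb_rep w) (dim w) < m by rewrite /m; lia.
  by move: (minn _ _) => x; rewrite /m; nia.
have base_le : (nth 0 w 0 + nb_guess w + s).+1 <= s * 2 ^ (m * m).
  rewrite [nth 0 w 0]/=.
  have -> : m * m = (m * m).-1.+1 by rewrite prednK // muln_gt0 /m addn_gt0 orbT.
  by rewrite expnS; move: (2 ^ _) guess_le => x; nia.
apply: leq_trans le_t _; apply: leq_trans (leq_mul (leqnn K) (leq_expl d base_le)) _.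
rewrite expnMn mulnCA mulnC leq_mul2r; apply/orP; right.
rewrite -expnM /time_factor -/m.
(* [K <= 2 ^ K] moves the coefficient into the exponent, leaving
   [K + m * m * d <= ((K + d) * m) ^ 2]. *)
apply: leq_trans (leq_mul (ltnW (ltn_expl K (ltnSn 1))) (leqnn _)) _.
rewrite -expnD leq_exp2l //.
have m0 : 0 < m * m by rewrite muln_gt0 /m addn_gt0 orbT.
rewrite mulnACA; apply: (@leq_trans ((K + d) * (m * m))).
  by rewrite mulnDl leq_add ?leq_pmulr // mulnC.
by rewrite leq_mul2r; apply/orP; right; case: (K + d) => // k; apply: leq_pmulr.
Qed.
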